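(* For each $d\in\mathbb{N}$ there exists a ($2$-dimensional, real, projective) superflow whose group of symmetries is the dihedral group $\mathbb{D}_{2d+1}$ (of order $4d+2$). There does not exist a ($2$-dimensional, real, projective) superflow whose group of symmetries is the dihedral group $\mathbb{D}_{2d}$ (of order $4d$), $d\in\mathbb{N}$, or a cyclic group $\mathbb{C}_{d}$ of order $d$, $d\in\mathbb{N}$. That is: for every $d\ge 1$ there is a subgroup $\Gamma\subset\mathrm{GL}(2,\mathbb{R})$ isomorphic to $\mathbb{D}_{2d+1}$ for which a projective $\Gamma$-superflow exists, and for no finite subgroup $\Gamma\subset\mathrm{GL}(2,\mathbb{R})$ isomorphic to $\mathbb{D}_{2d}$ or to $\mathbb{C}_{d}$ ($d\ge 1$) does a projective $\Gamma$-superflow exist.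
   Context: $\mathbb{N}=\{1,2,\dots\}$. A function $f$ on $\mathbb{R}^n$ is $2$-homogeneous if $f(t\mathbf{x})=t^2f(\mathbf{x})$. A projective flow is a map $\phi$ such that $\phi^{t}(\mathbf{x})=t^{-1}\phi(\mathbf{x}t)$ satisfies $\phi^{t+s}=\phi^{t}\circ\phi^{s}$ (for $s,t$ small enough) and $\lim_{t\to0}\phi^t(\mathbf{x})=\mathbf{x}$; its vector field is $\frac{d}{dt}\phi^t(\mathbf{x})|_{t=0}$, which is a tuple of $2$-homogeneous functions. Let $\Gamma\subset\mathrm{GL}(n,\mathbb{R})$ be a finite group. A projective flow $\phi$ is called the projective $\Gamma$-superflow if (i) its vector field $\mathbf{Q}=(Q_1,\dots,Q_n)\neq(0,\dots,0)$, whose components are $2$-homogeneous rational functions, satisfies $\gamma^{-1}\circ\mathbf{Q}\circ\gamma(\mathbf{x})=\mathbf{Q}(\mathbf{x})$ for all $\gamma\in\Gamma$ (here $\mathbf{Q}$ is viewed as a map $\mathbb{R}^n\to\mathbb{R}^n$ and $\gamma$ as a linear map); and (ii) every other $2$-homogeneous rational vector field $\mathbf{Q}'$ satisfying the same identity for all $\gamma\in\Gamma$ is either a scalar multiple of $\mathbf{Q}$, or the degree of its common denominator is higher than that of $\mathbf{Q}$. The common denominator is the polynomial $D$ in the reduced form $\mathbf{Q}=(P_1/D,\dots,P_n/D)$ with $\gcd(P_1,\dots,P_n,D)=1$. *)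

(* Defs.v *)
From mathcomp Require Import all_boot all_order all_algebra all_fingroup all_solvable.
From mathcomp Require Import all_classical all_reals all_analysis.
(* the notations of mpoly clash with those of mathcomp-analysis *)
From mathcomp Require Import -(notations) mpoly.

Set Implicit Arguments.
Unset Strict Implicit.
Unset Printing Implicit Defensive.

Import Order.TTheory GRing.Theory Num.Theory.
Import numFieldNormedType.Exports.
Local Open Scope classical_set_scope.
Local Open Scope ring_scope.

(* A rational vector field on R^n, in reduced form (P_1/D, ..., P_n/D) with
   gcd(P_1, ..., P_n, D) = 1.  Every n-tuple of rational functions has such a
   form, unique up to a common nonzero constant; the units of R[X_1, ..., X_n]
   are the nonzero constants. *)
Record ratVField (R : realType) (n : nat) := RatVField {
  vnum : 'I_n -> mpoly n R;
  vden : mpoly n R;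
  vden_neq0 : vden != 0;
  vreduced : forall G : mpoly n R,
    (forall i, exists A, vnum i = A * G) -> (exists B, vden = B * G) ->
    G \is a GRing.unit
}.

Section RationalVectorFields.
Context {R : realType} {n : nat}.
Implicit Types (Q : ratVField R n) (x : 'cV[R]_n).

Definition mpoly_at (p : mpoly n R) x : R := meval (fun i => x i ord0) p.

Definition vdom Q : set 'cV[R]_n := [set x | mpoly_at (vden Q) x != 0].

(* meaningful on [vdom Q] only *)
Definition vfun Q x : 'cV[R]_n :=
  \col_i (mpoly_at (vnum Q i) x / mpoly_at (vden Q) x).

Definition vnonzero Q : Prop := exists i, vnum Q i != 0.

(* The degree of a nonzero polynomial is its [msize] minus 1. *)
Definition den_degree Q : nat := (msize (vden Q)).-1.

Definition homogeneous2 Q : Prop := forall (t : R) x,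
  vdom Q x -> vdom Q (t *: x) -> vfun Q (t *: x) = t ^+ 2 *: vfun Q x.

Definition invariant_under (Gamma : set 'M[R]_n) Q : Prop :=
  forall gamma, Gamma gamma -> forall x,
    vdom Q x -> vdom Q (gamma *m x) ->
    invmx gamma *m vfun Q (gamma *m x) = vfun Q x.

Definition scalar_multiple Q' Q : Prop := exists c : R,
  forall x, vdom Q x -> vdom Q' x -> vfun Q' x = c *: vfun Q x.

End RationalVectorFields.

Section Superflows.
Context {R : realType} {n : nat}.
Implicit Types (phi : 'cV[R]_n -> 'cV[R]_n) (U : set 'cV[R]_n).

(* phi^t(x) = phi(t x) / t, with its limit x as value at t = 0 *)
Definition flow phi (t : R) (x : 'cV[R]_n) : 'cV[R]_n :=
  if t == 0 then x else t^-1 *: phi (t *: x).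

(* "s, t small enough" depends on the point x; U is the set of points where
   the conditions are imposed, the values of phi elsewhere being junk. *)
Definition projective_flow_on U phi : Prop := forall x, U x ->
  (exists2 delta : R, 0 < delta & forall s t : R,
     `|s| < delta -> `|t| < delta ->
     flow phi (t + s) x = flow phi t (flow phi s x)) /\
  (flow phi t x @[t --> (0 : R)^'] --> x).

Definition vector_field_on U phi (V : 'cV[R]_n -> 'cV[R]_n) : Prop :=
  forall x, U x -> is_derive (0 : R) (1 : R) (fun t : R => flow phi t x) (V x).

(* A flow is considered on the domain of definition of its vector field. *)
Definition superflow (Gamma : set 'M[R]_n) phi : Prop :=
  exists Q : ratVField R n,
    [/\ projective_flow_on (vdom Q) phi,
        vector_field_on (vdom Q) phi (vfun Q),
        [/\ vnonzero Q, homogeneous2 Q & invariant_under Gamma Q] &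
        forall Q' : ratVField R n,
          homogeneous2 Q' -> invariant_under Gamma Q' ->
          scalar_multiple Q' Q \/ (den_degree Q < den_degree Q')%N].

End Superflows.

Section LinearGroups.
Context {R : realType} {n : nat}.

Definition finite_linear_group (Gamma : set 'M[R]_n) : Prop :=
  [/\ finite_set Gamma,
      forall g, Gamma g -> g \in unitmx,
      Gamma 1%:M,
      forall g h, Gamma g -> Gamma h -> Gamma (g *m h) &
      forall g, Gamma g -> Gamma (invmx g)].

Definition linear_isog (Gamma : set 'M[R]_n) (gT : finGroupType)
    (G : {group gT}) : Prop :=
  exists2 f : gT -> 'M[R]_n,
    set_bij [set g | g \in G] Gamma f &
    {in G &, forall g h, f (g * h)%g = f g *m f h}.

End LinearGroups.

(* [dihedral_gtype m] is the library's dihedral group 'D_m, indexed by its order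
   (the notation 'D_m is shadowed here by that of directional derivatives). *)
Definition dihedral_group (k : nat) : {group dihedral_gtype k.*2} :=
  [set: dihedral_gtype k.*2]%G.

(* [Zp k] is the library's additive cyclic group of order k, for k >= 1; it is
   trivial for k = 1, although the ambient type 'Z_1 has two elements. *)
Definition cyclic_group (k : nat) : {group 'Z_k} := Zp_group k.

(* Main.v *)
From HB Require Import structures.
Require Import Defs.
From mathcomp Require Import all_boot all_order all_algebra all_fingroup all_solvable.
From mathcomp Require Import all_classical all_reals all_analysis.
From mathcomp Require Import -(notations) mpoly.
From mathcomp Require Import complex ring lra zify.

(** Identify the plane with the complex numbers and write [m = 2 d + 1 = 2 k + 3].

    Existence. The dihedral group of order [2 m] acts by [z |-> w z] with [w ^ m = 1] and
    [z |-> w conj z]. The field [conj z ^ (m - 1) / (z conj z) ^ k] is homogeneous of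
    degree 2 and invariant; it is in reduced form because [z] and [conj z] have no common
    factor ([base_reduced]).

    Minimality. Let [P / D] be another invariant field, written in the variables [z] and
    [conj z], with [D] of degree at most [2 k = m - 3]. Invariance under a primitive
    rotation [w] and homogeneity for the factor 2 combine into
    [P(2 w z, 2 w^-1 z') D(z, z') = 4 w P(z, z') D(2 w z, 2 w^-1 z')]. The substitution is
    diagonal on monomials, and the identity propagates to every polynomial in it. Lagrange
    interpolation then isolates one monomial [nu] of top degree of [D]:
    [P d_nu X^nu = p_mu X^mu D] for one monomial [mu] of [P] ([isolate_monomial]). As [D]
    is real, its monomials come in pairs [(a, b), (b, a)]; comparing the two identities,
    the congruence on exponents modulo [m] leaves only [nu = (k, k)] and [mu = (0, m - 1)]
    ([exponents_solve]). So [P / D] is a complex multiple of the field above, and the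
    reflection [z |-> conj z] makes the factor real ([base_field_minimal]).

    Flow. The derivative of [z ^ m] along the field is real, so [Im (z ^ m)] is constant on
    orbits. Where it is a nonzero number [h], an orbit is the curve [c (1 - i s) ^ (1/m)]
    with [c ^ m = i h], and [s] satisfies an autonomous equation whose right-hand side
    has constant sign, solved by one quadrature ([separation_of_variables]). On the rays where it vanishes, the motion
    is that of [r' = K r ^ 2]. The flow laws and the derivative at time 0 follow
    ([base_flowD], [is_derive_base_flow]).

    Nonexistence. If [-1] is in the group, homogeneity with the factor [-1] and invariance
    make the field vanish ([no_antipodal_field]). This covers the groups of order [4 d]: a
    subgroup of order 4 is abelian and contains an involution, and a map of finite order
    that commutes with a reflection [Z] is one of [1, -1, Z, -Z] ([antipode_of_order4]). Let
    now the group be abelian without [-1], and [g] one of its elements. The image [g Q] of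
    a superflow field [Q] is invariant with the same denominator, hence is proportional to
    [Q]; so [g] has a real eigenvector, and [g ^ 2 = 1] as [g] has finite order
    ([commuting_element_involution]). The group is thus contained in [{1, g}] for a
    reflection [g]; it then leaves invariant two polynomial quadratic fields along the two
    axes of [g], which are not both multiples of [Q] ([reflection_not_minimal]). *)

Import Order.TTheory GRing.Theory Num.Theory.
Import numFieldNormedType.Exports.

Set Implicit Arguments.
Unset Strict Implicit.
Unset Printing Implicit Defensive.
Local Open Scope ring_scope.
Local Open Scope complex_scope.

(** * Polynomials vanishing at all natural points *)

Section ZeroTest.
Variable K : numDomainType.

Lemma poly_eq0_nat (p : {poly K}) : (forall k : nat, p.[k%:R] = 0) -> p = 0.
Proof.
move=> p0; apply/eqP; case: (eqVneq p 0) => // pN0.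
have /= := max_poly_roots pN0 (rs := [seq i%:R | i <- iota 0 (size p)]).
rewrite size_map size_iota ltnn; apply.
  by apply/allP => x /mapP[i _ ->]; rewrite /root p0.
rewrite map_inj_uniq ?iota_uniq// => i j /eqP.
by rewrite eqr_nat => /eqP.
Qed.

(** [muni] reads the last variable as the variable of a univariate polynomial. *)
Lemma muni_eq0 n (p : mpoly n.+1 K) : muni p = 0 -> p = 0.
Proof.
move=> mp0; apply/mpolyP => m; rewrite mcoeff0.
pose tr (m : multinom n.+1) : multinom n :=
  Multinom [tuple m (widen_ord (leqnSn n) i) | i < n].
have trI (m1 m2 : multinom n.+1) :
    tr m1 = tr m2 -> m1 ord_max = m2 ord_max -> m1 = m2.
  move=> E Em; apply/mnmP => i; case: (unliftP ord_max i) => [j ->|-> //].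
  have /mnmP/(_ j) := E; rewrite /fun_of_multinom /= !tnth_mktuple.
  by rewrite -!/(fun_of_multinom _ _); have -> : lift ord_max j = widen_ord (leqnSn n) j
    by apply: val_inj; rewrite /= /bump leqNgt ltn_ord.
have := congr1 (fun q : {poly mpoly n K} => mcoeff (tr m) q`_(m ord_max)) mp0.
rewrite coef0 mcoeff0 muniE coef_sum raddf_sum /= => E0.
have [mp|] := boolP (m \in msupp p); last by move/memN_msupp_eq0.
rewrite -[RHS]E0 (bigD1_seq m) ?msupp_uniq //=.
rewrite coefZ coefXn eqxx mulr1 mcoeffZ mcoeffX eqxx mulr1.
rewrite big1 ?addr0// => m' m'm.
rewrite coefZ coefXn; case: eqP => [Em|]; last by rewrite mulr0 mcoeff0.
rewrite mulr1 mcoeffZ mcoeffX; case: eqP => [Et|]; last by rewrite mulr0.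
by move: m'm; rewrite (trI _ _ Et (esym Em)) eqxx.
Qed.

Lemma meval_muni n (p : mpoly n.+1 K) (v : 'I_n.+1 -> K) :
  meval v p = (map_poly (meval (v \o widen_ord (leqnSn n))) (muni p)).[v ord_max].
Proof.
rewrite muniE mevalE rmorph_sum /= horner_sum; apply: eq_bigr => m _.
rewrite map_polyZ /= map_polyXn hornerZ hornerXn mevalZ mevalX big_ord_recr /= mulrA.
congr (_ * _ * _); apply: eq_bigr => i _; congr (_ ^+ _).
by rewrite /fun_of_multinom /= tnth_mktuple.
Qed.

(** Identities between rational functions are only known where the denominators do not
    vanish, and are turned into polynomial identities by this test. *)
Lemma mpoly_eq0_nat n (p : mpoly n K) :
  (forall v : 'I_n -> nat, meval (fun i => (v i)%:R) p = 0) -> p = 0.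
Proof.
elim: n p => [|n IHn] p p0.
  have := p0 (fun=> 0%N); rewrite [p]nvar0_mpolyC mevalC => ->.
  by rewrite mpolyC0.
apply: muni_eq0; apply/polyP => k; rewrite coef0.
apply: IHn => v.
have -> : meval (fun i => (v i)%:R) (muni p)`_k =
    (map_poly (meval (fun i => (v i)%:R)) (muni p))`_k by rewrite coef_map.
rewrite (_ : map_poly _ _ = 0) ?coef0 //; apply: poly_eq0_nat => l.
pose w (i : 'I_n.+1) := if unlift ord_max i is Some j then v j else l.
have := p0 w; rewrite meval_muni => E.
rewrite -[RHS]E {2}/w unlift_none; congr (_.[_]); apply: eq_map_poly => q.
apply: meval_eq => i /=; congr _%:R.
rewrite /w (_ : widen_ord _ _ = lift ord_max i) ?liftK//.
by apply: val_inj; rewrite /= /bump leqNgt ltn_ord.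
Qed.
End ZeroTest.

(** * Diagonal operators on polynomials in two variables *)

Section Monomials.
Variable K : idomainType.
Implicit Types (p q : mpoly 2 K) (m : multinom 2).

Definition mono2 (a b : nat) : multinom 2 := Multinom [tuple a; b].

Lemma ord2P (i : 'I_2) : i = ord0 \/ i = ord_max.
Proof. by case: i => -[|[|//]] ilt; [left|right]; apply: val_inj. Qed.

Lemma mono2E m : m = mono2 (m ord0) (m ord_max).
Proof.
by apply/mnmP => i; case: (ord2P i) => ->; rewrite /mono2 /fun_of_multinom.
Qed.

Lemma mdeg2E m : mdeg m = (m ord0 + m ord_max)%N.
Proof. by rewrite mdegE big_ord_recr big_ord1 /=; congr (m _ + _)%N; apply: val_inj. Qed.

Lemma meval2X (v : 'I_2 -> K) m :
  meval v (mpolyX K m) = v ord0 ^+ m ord0 * v ord_max ^+ m ord_max.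
Proof.
rewrite mevalX big_ord_recr big_ord1 /=; congr (v _ ^+ m _ * _); exact: val_inj.
Qed.

(** Polynomials in a diagonal substitution are no longer substitutions, but they still act
    diagonally on monomials; [mweight] is their common form. *)
Definition mweight (phi : multinom 2 -> K) p : mpoly 2 K :=
  \sum_(m <- msupp p) (phi m * mcoeff m p) *: mpolyX K m.

Lemma mcoeff_mweight phi p m : mcoeff m (mweight phi p) = phi m * mcoeff m p.
Proof.
rewrite /mweight raddf_sum /=; under eq_bigr do rewrite mcoeffZ mcoeffX.
have [mp|mp] := boolP (m \in msupp p).
  by rewrite (bigD1_seq m) ?msupp_uniq//= eqxx mulr1 big1 ?addr0// => m' /negPf ->; rewrite mulr0.
rewrite (memN_msupp_eq0 mp) mulr0 big_seq big1// => m' m'p.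
case: eqP => [mm|_]; last by rewrite mulr0.
by rewrite -mm m'p in mp.
Qed.

Definition mscale (l0 l1 : K) : mpoly 2 K -> mpoly 2 K :=
  comp_mpoly [tuple l0 *: mpolyX K (mnm1 ord0); l1 *: mpolyX K (mnm1 ord_max)].

Lemma mscaleM l0 l1 p q : mscale l0 l1 (p * q) = mscale l0 l1 p * mscale l0 l1 q.
Proof. exact: rmorphM. Qed.

Lemma mscaleE l0 l1 p :
  mscale l0 l1 p = mweight (fun m => l0 ^+ m ord0 * l1 ^+ m ord_max) p.
Proof.
rewrite /mscale comp_mpolyEX; apply: eq_bigr => m _.
rewrite comp_mpolyX big_ord_recr big_ord1 /= !(tnth_nth 0) /=.
have -> : widen_ord (leqnSn 1) ord0 = ord0 by apply: val_inj.
rewrite !exprZn -scalerAl -scalerAr !scalerA !mpolyXn -mpolyXD.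
congr (_ *: mpolyX _ _); first ring.
apply/mnmP => i.
by rewrite mnmDE !mulmnE !mnm1E; case: (ord2P i) => -> /=; lia.
Qed.

Lemma mcoeff_mscale l0 l1 p m :
  mcoeff m (mscale l0 l1 p) = l0 ^+ m ord0 * l1 ^+ m ord_max * mcoeff m p.
Proof. by rewrite mscaleE mcoeff_mweight. Qed.

Lemma meval_mscale l0 l1 p (v : 'I_2 -> K) :
  meval v (mscale l0 l1 p) = meval (fun i => (if i == ord0 then l0 else l1) * v i) p.
Proof.
rewrite /mscale comp_mpoly_meval; apply: meval_eq => i.
by case: (ord2P i) => ->; rewrite (tnth_nth 0) /= mevalZ mevalXU.
Qed.

Lemma mscale_neq0 l0 l1 p : l0 != 0 -> l1 != 0 -> p != 0 -> mscale l0 l1 p != 0.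
Proof.
move=> l00 l10; apply: contraNneq => E; apply/eqP/mpolyP => m.
have /eqP := mcoeff_mscale l0 l1 p m.
by rewrite E !mcoeff0 eq_sym !mulf_eq0 !expf_eq0 (negPf l00) (negPf l10) !andbF => /eqP.
Qed.

Lemma mweight_iter l0 l1 p j :
  mweight (fun m => (l0 ^+ m ord0 * l1 ^+ m ord_max) ^+ j) p = iter j (mscale l0 l1) p.
Proof.
elim: j => [|j IHj] /=; apply/mpolyP => m.
  by rewrite mcoeff_mweight mul1r.
by rewrite mcoeff_mscale -IHj !mcoeff_mweight exprS mulrA.
Qed.

Lemma mweight_horner (P : {poly K}) (lam : multinom 2 -> K) (c : K) p :
  mweight (fun m => P.[c * lam m]) p =
  \sum_(j < size P) (P`_j * c ^+ j) *: mweight (fun m => lam m ^+ j) p.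
Proof.
apply/mpolyP => m; rewrite mcoeff_mweight raddf_sum /= horner_coef mulr_suml.
apply: eq_bigr => j _; rewrite mcoeffZ mcoeff_mweight exprMn; ring.
Qed.
End Monomials.

(** * Covariant rational functions *)

Section Arith.
(** Confines the quotient [q] of a congruence to a short interval. *)
Lemma lt_mul_int (q x : int) (n l u : nat) :
  x = q * n%:Z -> - (l%:Z * n%:Z) < x -> x < u%:Z * n%:Z -> - l%:Z < q < u%:Z.
Proof.
move=> -> lx xu; have n0 : 0 < n%:Z.
  by case: n lx xu => // lx xu; rewrite !mulr0 ltxx in xu.
by rewrite -mulNr ltr_pM2r// in lx; rewrite ltr_pM2r// in xu; rewrite lx xu.
Qed.

(** On an antidiagonal the residue of [a - b] determines [2 a] modulo [n], and [a] ranges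
    over at most [n] consecutive values. *)
Lemma antidiagonal_inj (n a b c d : nat) (q : int) : odd n ->
  (a + b = c + d)%N -> (a + b < n)%N ->
  a%:Z + d%:Z = c%:Z + b%:Z + q * n%:Z -> a = c /\ b = d.
Proof.
move=> n_odd e1 lt1 qE.
have qE' : 2 * a%:Z - 2 * c%:Z = q * n%:Z by lia.
have : - 2%N%:Z < q < 2%N%:Z by apply: (lt_mul_int qE'); lia.
by case: (eqVneq q 0) qE => [->|q0 qE] ; [lia|case: (eqVneq q 1) qE qE' => [->|]; lia].
Qed.

(** [(a, b)] is the exponent of a top-degree monomial of the denominator, [(c, d)] and
    [(c', d')] those of the numerator paired with it and with its mirror image [(b, a)].
    Adding the congruence to the degree relation gives [2 (c - a) = 3 + q n], where [q] is
    odd and confined to [-1]; the crosswise relation gives [2 (c' - b) = 3 - n] as well.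
    So [a] and [b] are both at least [(n - 3) / 2], while [a + b <= n - 3]. *)
Lemma exponents_solve (n e a b c d c' d' : nat) (q : int) : odd n ->
  (e + 3 <= n)%N -> (a + b <= e)%N -> (c + d = 2 + (a + b))%N ->
  (c' + d' = 2 + (b + a))%N -> (c + b = c' + a)%N ->
  c%:Z + b%:Z = 1 + a%:Z + d%:Z + q * n%:Z ->
  [/\ a = b, c = 0%N, d = n.-1 & n = a.*2.+3].
Proof.
move=> n_odd en ele e1 e2 e3 qE.
have qE' : 2 * c%:Z - 2 * a%:Z - 3 = q * n%:Z by lia.
have : - 2%N%:Z < q < 1%N%:Z by apply: (lt_mul_int qE'); lia.
case: (eqVneq q 0) qE' => [->|q0 qE' qlt]; first by lia.
have q1 : q = -1 by lia.
by rewrite q1 in qE'; split; lia.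
Qed.
End Arith.

Section Classification.
Variable K : numFieldType.
Implicit Types (p D : mpoly 2 K) (mu nu : multinom 2).

Lemma mscaleZ l0 l1 (c : K) p : mscale l0 l1 (c *: p) = c *: mscale l0 l1 p.
Proof. exact: comp_mpolyZ. Qed.

(** The ratio [p / D] is an eigenvector of the substitution, hence of its powers. *)
Lemma iter_mscale_cross l0 l1 (c : K) p D : D != 0 -> l0 != 0 -> l1 != 0 ->
  mscale l0 l1 p * D = c *: (p * mscale l0 l1 D) ->
  forall j, iter j (mscale l0 l1) p * D = c ^+ j *: (p * iter j (mscale l0 l1) D).
Proof.
move=> D0 l00 l10 E; elim=> [|j IHj]; first by rewrite scale1r.
apply: (mulIf (mscale_neq0 l00 l10 D0)).
have := congr1 (mscale l0 l1) IHj.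
rewrite mscaleZ !mscaleM => E'.
rewrite /= mulrAC E' -!scalerAl mulrAC E -scalerAl scalerA -exprSr.
by congr (_ *: _); ring.
Qed.

Lemma mweight_cross l0 l1 (c : K) p D : D != 0 -> l0 != 0 -> l1 != 0 ->
  mscale l0 l1 p * D = c *: (p * mscale l0 l1 D) ->
  let lam nu := l0 ^+ nu ord0 * l1 ^+ nu ord_max in
  forall P : {poly K},
  mweight (fun mu => P.[lam mu]) p * D = p * mweight (fun nu => P.[c * lam nu]) D.
Proof.
move=> D0 l00 l10 E lam P.
rewrite mweight_horner mulr_sumr.
have -> : mweight (fun mu => P.[lam mu]) p = mweight (fun mu => P.[1 * lam mu]) p.
  by congr mweight; apply: funext => mu; rewrite mul1r.
rewrite mweight_horner mulr_suml; apply: eq_bigr => j _.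
rewrite !mweight_iter expr1n mulr1 -scalerAl (iter_mscale_cross D0 l00 l10 E).
by rewrite scalerA -scalerAr.
Qed.

Lemma mweight_single (phi : multinom 2 -> K) p mu :
  (forall mu', mu' \in msupp p -> phi mu' != 0 -> mu' = mu) ->
  mweight phi p = (phi mu * mcoeff mu p) *: mpolyX K mu.
Proof.
move=> H; apply/mpolyP => m; rewrite mcoeff_mweight mcoeffZ mcoeffX.
case: eqP => [->|mmu]; first by rewrite mulr1.
rewrite mulr0; case: (eqVneq (phi m) 0) => [->|phim]; first by rewrite mul0r.
have [mp|/memN_msupp_eq0 ->] := boolP (m \in msupp p); last by rewrite mulr0.
by case: mmu; rewrite (H m).
Qed.

(** [mweight_cross] is applied to the polynomial [P] that vanishes at all eigenvalues that
    occur except the one of [nu]: both sums then collapse to a single monomial. *)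
Lemma isolate_monomial l0 l1 (c : K) p D nu :
  D != 0 -> p != 0 -> l0 != 0 -> l1 != 0 ->
  mscale l0 l1 p * D = c *: (p * mscale l0 l1 D) ->
  let lam nu := l0 ^+ nu ord0 * l1 ^+ nu ord_max in
  nu \in msupp D ->
  (forall nu', nu' \in msupp D -> c * lam nu' = c * lam nu -> nu' = nu) ->
  (forall mu mu', mu \in msupp p -> mu' \in msupp p ->
     lam mu = c * lam nu -> lam mu' = c * lam nu -> mu = mu') ->
  exists2 mu, mu \in msupp p /\ lam mu = c * lam nu &
    p * (mcoeff nu D *: mpolyX K nu) = (mcoeff mu p *: mpolyX K mu) * D.
Proof.
move=> D0 p0 l00 l10 E lam nuD injD injp.
pose S := [seq s <- [seq lam mu | mu <- msupp p] ++ [seq c * lam nu' | nu' <- msupp D] | s != c * lam nu].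
pose P : {poly K} := \prod_(s <- S) ('X - s%:P).
have P0 s : s != c * lam nu ->
    (s \in [seq lam mu | mu <- msupp p]) || (s \in [seq c * lam nu' | nu' <- msupp D]) -> P.[s] = 0.
  by move=> s1 s2; apply/eqP; rewrite -/(root P s) root_prod_XsubC mem_filter s1 mem_cat.
have PN0 : P.[c * lam nu] != 0.
  by rewrite -/(root P _) root_prod_XsubC mem_filter eqxx.
have : mweight (fun mu => P.[lam mu]) p * D = p * mweight (fun nu => P.[c * lam nu]) D.
  exact: (mweight_cross D0 l00 l10 E P).
rewrite (@mweight_single _ D nu); last first.
  move=> nu' nu'D; apply: contra_neq_eq => n.
  apply: P0; last by rewrite (map_f (fun x => c * lam x) nu'D) orbT.
  by apply: contra_neq n; exact: injD.
have [/hasP[mu mup /eqP lmu]|/hasPn noP] := boolP (has (fun mu => lam mu == c * lam nu) (msupp p)).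
  rewrite (@mweight_single _ p mu); last first.
    move=> mu' mu'p; apply: contra_neq_eq => n.
    apply: P0; last by rewrite (map_f lam mu'p).
    by apply: contra_neq n => lmu'; exact: injp.
  rewrite lmu; move: P.[_] PN0 => a a0.
  rewrite -!scalerA -scalerAl -scalerAr => /(can_inj (scalerK a0)) H.
  by exists mu.
rewrite (@mweight_single _ p (mono2 0 0)); last first.
  move=> mu' mu'p; apply: contra_neq_eq => n.
  by apply: P0; [exact: noP|rewrite (map_f lam mu'p)].
have -> : P.[lam (mono2 0 0)] * mcoeff (mono2 0 0) p = 0.
  have [/[dup]Z/noP n|/memN_msupp_eq0 ->] := boolP ((mono2 0 0) \in msupp p); last by rewrite mulr0.
  by rewrite P0 ?mul0r// (map_f lam Z).
rewrite scale0r mul0r => /esym/eqP; rewrite mulf_eq0 (negPf p0) /=.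
move=> /eqP /(congr1 (mcoeff nu)) /eqP.
rewrite mcoeffZ mcoeffX eqxx mulr1 mcoeff0 mulf_eq0 (negPf PN0) /=.
by rewrite mcoeff_eq0 nuD.
Qed.

Variables (n : nat) (w : K).
Hypotheses (wP : n.-primitive_root w) (w1 : `|w| = 1).

Let w_neq0 : w != 0.
Proof. by rewrite -normr_eq0 w1 oner_neq0. Qed.

Lemma eqn_mod_int (a b : nat) : a = b %[mod n] -> exists q : int, a%:Z = b%:Z + q * n%:Z.
Proof.
move=> E; exists ((a %/ n)%N%:Z - (b %/ n)%N%:Z).
have := divn_eq a n; have := divn_eq b n; rewrite E; lia.
Qed.

Let lam nu := (2 * w) ^+ nu ord0 * (2 * w^-1) ^+ nu ord_max.

(** The modulus of an eigenvalue of the substitution is a power of 2 and records the total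
    degree; its argument is a power of [w] and records [mu_0 - mu_1] modulo [n]. *)
Lemma eigenvalue_mono r k mu nu : lam mu = 2 ^+ r * w ^+ k * lam nu ->
  mdeg mu = (r + mdeg nu)%N /\
  exists q : int, (mu ord0)%:Z + (nu ord_max)%:Z =
    k%:Z + (nu ord0)%:Z + (mu ord_max)%:Z + q * n%:Z.
Proof.
rewrite /lam => E.
have {}E : 2 ^+ mdeg mu * w ^+ (mu ord0 + nu ord_max) =
    2 ^+ (r + mdeg nu) * w ^+ (k + nu ord0 + mu ord_max).
  have := congr1 (fun x => x * (w ^+ mu ord_max * w ^+ nu ord_max)) E.
  rewrite !mdeg2E !exprMn !exprD !exprVn => {}E.
  have wm := expf_neq0 (mu ord_max) w_neq0; have wn := expf_neq0 (nu ord_max) w_neq0.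
  by apply: etrans (etrans E _); field; rewrite ?wm ?wn.
have dE : mdeg mu = (r + mdeg nu)%N.
  have /eqP := congr1 Num.norm E.
  rewrite !normrM !normrX w1 !expr1n !mulr1 normr_nat -!natrX eqr_nat.
  by rewrite eqn_exp2l// => /eqP.
split=> //; move: E; rewrite dE => /(mulfI _) E.
have two0 : 2 ^+ (r + mdeg nu) != 0 :> K by rewrite expf_neq0 ?pnatr_eq0.
move: (E two0) => /eqP.
rewrite (eq_prim_root_expr wP) => /eqP/eqn_mod_int[q qE]; exists q.
by move: qE; clear; lia.
Qed.

(** The symmetry of the support of [D] expresses that [D] is real. It supplies a second
    top-degree monomial, the mirror image of the first; [n - 3 >= e] makes eigenvalues
    simple on the top-degree part. *)
Lemma rational_covariant p D e : odd n ->
  D != 0 -> p != 0 -> (e + 3 <= n)%N ->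
  (forall nu, nu \in msupp D -> mdeg nu <= e)%N ->
  (forall a b, mono2 a b \in msupp D -> mono2 b a \in msupp D) ->
  mscale (2 * w) (2 * w^-1) p * D = (4 * w) *: (p * mscale (2 * w) (2 * w^-1) D) ->
  exists2 k, n = k.*2.+3 & exists c,
    p * mpolyX K (mono2 k k) = c *: (mpolyX K (mono2 0 n.-1) * D).
Proof.
move=> n_odd D0 p0 en Dle Dsym E.
have l00 : 2 * w != 0 by rewrite mulf_neq0 ?pnatr_eq0.
have l10 : 2 * w^-1 != 0 by rewrite mulf_neq0 ?pnatr_eq0 ?invr_neq0.
have cE : 4 * w = 2 ^+ 2 * w ^+ 1 :> K by ring.
pose top := mlead D.
have topD : top \in msupp D by rewrite mlead_supp.
have iso nu : nu \in msupp D -> mdeg nu = mdeg top ->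
  exists mu, [/\ mu \in msupp p, mdeg mu = (2 + mdeg nu)%N,
    exists q : int, (mu ord0)%:Z + (nu ord_max)%:Z =
      1%:Z + (nu ord0)%:Z + (mu ord_max)%:Z + q * n%:Z &
    p * (mcoeff nu D *: mpolyX K nu) = (mcoeff mu p *: mpolyX K mu) * D].
  move=> nuD nutop; have ele := Dle _ nuD.
  case: (isolate_monomial D0 p0 l00 l10 E nuD).
  - move=> nu' nu'D /(mulfI (mulf_neq0 _ w_neq0)).
    rewrite pnatr_eq0 => /(_ isT) lE.
    have [|dE [q qE]] := @eigenvalue_mono 0 0 nu' nu; first by rewrite !mul1r.
    rewrite !mdeg2E in ele dE *; rewrite [nu']mono2E [nu]mono2E.
    suff [-> ->] : nu' ord0 = nu ord0 /\ nu' ord_max = nu ord_max by [].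
    move: n_odd en ele dE qE; clear => n_odd en ele dE qE.
    by apply: (@antidiagonal_inj n _ _ _ _ q n_odd); lia.
  - move=> mu mu' mup mu'p lE lE'.
    have [|dEE _] := @eigenvalue_mono 2 1 mu nu; first by rewrite -cE; exact: lE.
    have [|dE [q qE]] := @eigenvalue_mono 0 0 mu' mu; first by rewrite !mul1r; exact: etrans lE' (esym lE).
    rewrite !mdeg2E in ele dE dEE *; rewrite [mu']mono2E [mu]mono2E.
    suff [-> ->] : mu' ord0 = mu ord0 /\ mu' ord_max = mu ord_max by [].
    move: n_odd en ele dE dEE qE; clear => n_odd en ele dE dEE qE.
    by apply: (@antidiagonal_inj n _ _ _ _ q n_odd); lia.
  - move=> mu [mup]; rewrite cE => /eigenvalue_mono[dE [q qE]] H.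
    by exists mu; split=> //; exists q.
(* The identities for [top] and its mirror image [bot] are multiplied crosswise, which
   relates the numerator monomials [mu] and [mu'] that go with them. *)
pose bot := mono2 (top ord_max) (top ord0).
have botD : bot \in msupp D by apply: Dsym; rewrite -mono2E.
have [mu [mup dmu [q qE] muE]] := iso _ topD erefl.
have [|mu' [mu'p dmu' [q' q'E] mu'E]] := iso _ botD; first by rewrite !mdeg2E addnC.
have cross : mnm_add mu bot = mnm_add mu' top.
  have := congr1 (fun r => r * (mcoeff bot D *: mpolyX K bot)) muE.
  rewrite /= mulrAC mu'E mulrAC [RHS]mulrAC => /(mulIf D0).
  rewrite -!scalerAl -!scalerAr !scalerA -!mpolyXD => /(congr1 (mcoeff (mnm_add mu bot))).
  rewrite !mcoeffZ !mcoeffX eqxx mulr1; case: eqP => [//|_].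
  by move=> /esym/eqP; rewrite mulr0 mulf_eq0 !mcoeff_eq0 mup botD.
have cross0 := congr1 (fun m : multinom 2 => m ord0) cross.
have ele := Dle _ topD; move: cross0; rewrite !mnmDE => cross0.
have [bot0 bot1] : bot ord0 = top ord_max /\ bot ord_max = top ord0 by [].
rewrite !mdeg2E in dmu dmu' ele; rewrite bot0 bot1 in dmu' q'E cross0.
have [ab c0 dn nk] := exponents_solve n_odd en ele dmu dmu' cross0 qE.
exists (top ord0); first exact: nk.
exists ((mcoeff top D)^-1 * mcoeff mu p).
have -> : mono2 (top ord0) (top ord0) = top by rewrite [RHS]mono2E -ab.
have -> : mono2 0 n.-1 = mu by rewrite [RHS]mono2E c0 dn.
have tD : mcoeff top D != 0 by rewrite mcoeff_eq0 topD.
rewrite -scalerA scalerAl -muE -scalerAr scalerA mulVf// scale1r//.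
Qed.
End Classification.

(** * Complex coordinates on the plane *)

Section ComplexCoordinates.
Variable R : realType.
Local Notation C := R[i].
Implicit Types (p : mpoly 2 R) (q : mpoly 2 C) (x : 'cV[R]_2) (z : C).

Definition toC x : C := Complex (x ord0 ord0) (x ord_max ord0).
Definition ofC z : 'cV[R]_2 :=
  \col_i (if i == ord0 then complex.Re z else complex.Im z).

Lemma toCK : cancel toC ofC.
Proof.
by move=> x; apply/matrixP => i j; rewrite ord1 mxE; case: (ord2P i) => ->.
Qed.

Lemma ofCK : cancel ofC toC.
Proof. by case=> a b; rewrite /toC !mxE. Qed.

Arguments toC : simpl never.

Definition zzbar z (i : 'I_2) : C := if i == ord0 then z else conjc z.

Definition xy_of_zzbar (i : 'I_2) : mpoly 2 C :=
  let X0 := mpolyX C (mnm1 ord0) in let X1 := mpolyX C (mnm1 ord_max) in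
  if i == ord0 then 2^-1 *: (X0 + X1) else (2^-1 * 'i%C) *: (X1 - X0).
End ComplexCoordinates.

(** Rotations are diagonal in [z = x + i y] and [conj z], not in [x] and [y]: a real
    polynomial in [x, y] is rewritten in these two variables. *)
HB.lock Definition mcomplex (R : realType) (p : mpoly 2 R) : mpoly 2 R[i] :=
  mmap (@mpolyC 2 R[i] \o real_complex R) (@xy_of_zzbar R) p.

Section ComplexPolynomials.
Variable R : realType.
Local Notation C := R[i].
Implicit Types (p : mpoly 2 R) (q : mpoly 2 C) (x : 'cV[R]_2) (z : C).

Let X0 : mpoly 2 C := mpolyX C (mnm1 ord0).
Let X1 : mpoly 2 C := mpolyX C (mnm1 ord_max).

Lemma mcomplexE p : mcomplex p =
   \sum_(m <- msupp p) (mcoeff m p)%:C *: \prod_i @xy_of_zzbar R i ^+ m i.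
Proof. by rewrite mcomplex.unlock; apply: eq_bigr => m _; rewrite /= mul_mpolyC. Qed.

Lemma meval_mcomplex p x :
  meval (zzbar (toC x)) (mcomplex p) = (mpoly_at p x)%:C.
Proof.
rewrite mcomplexE /mpoly_at [meval _ p]mevalE !rmorph_sum /=; apply: eq_bigr => m _.
rewrite mevalZ !rmorphM !rmorph_prod /=; congr (_ * _); apply: eq_bigr => i _.
rewrite !rmorphXn /=; congr (_ ^+ _).
case: (ord2P i) => ->; rewrite /xy_of_zzbar /= mevalZ mevalD ?mevalN !mevalXU /zzbar [_ == _]/=.
  by rewrite -[x _ _]/(complex.Re (toC x)) ReJ_add (_ : (ord_max == _) = false)// eqxx; ring.
by rewrite -[x _ _]/(complex.Im (toC x)) ImJ_sub eqxx mulrC mulrA.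
Qed.

(** The points [(z, conj z)] are Zariski dense: [x] and [y] run independently over the
    natural numbers when [z = x + i y]. *)
Lemma mpoly_eq0_zzbar q : (forall z, meval (zzbar z) q = 0) -> q = 0.
Proof.
move=> q0.
pose q' := comp_mpoly [tuple X0 + 'i%C *: X1; X0 - 'i%C *: X1] q.
have q'E (v : 'I_2 -> C) : meval v q' =
    meval (fun i => if i == ord0 then v ord0 + 'i%C * v ord_max else v ord0 - 'i%C * v ord_max) q.
  rewrite /q' comp_mpoly_meval; apply: meval_eq => i.
  by case: (ord2P i) => ->; rewrite (tnth_nth 0) /= mevalD ?mevalN !mevalZ !mevalXU.
have q'0 : q' = 0.
  apply: mpoly_eq0_nat => v; rewrite q'E -[RHS](q0 ((v ord0)%:R + 'i%C * (v ord_max)%:R)).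
  apply: meval_eq => i; rewrite /zzbar; case: (ord2P i) => -> //=.
  rewrite rmorphD rmorphM /= !rmorph_nat; congr (_ + _).
  by rewrite -mulNr; congr (_ * _); simpc.
apply: mpoly_eq0_nat => v.
pose u (i : 'I_2) : C := if i == ord0 then ((v ord0)%:R + (v ord_max)%:R) / 2
  else ((v ord_max)%:R - (v ord0)%:R) / 2 * 'i%C.
have := q'E u; rewrite q'0 meval0 => ->; apply: meval_eq => i.
have i2 : 'i%C * 'i%C = -1 :> C by rewrite -expr2 sqr_i.
have E (a : C) : 'i%C * (a / 2 * 'i%C) = - (a / 2) by rewrite mulrCA i2 mulrN1.
have half (F : numFieldType) (a b : F) :
    a = (a + b) / 2 - (b - a) / 2 /\ b = (a + b) / 2 - - ((b - a) / 2).
  by split; field.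
by have [h0 h1] := half C (v ord0)%:R (v ord_max)%:R; case: (ord2P i) => -> /=; rewrite /u /= E.
Qed.

Lemma mcomplex_eq0 p : mcomplex p = 0 -> p = 0.
Proof.
move=> p0; apply: mpoly_eq0_nat => v; apply: (@complexI R).
have := meval_mcomplex p (ofC (Complex (v ord0)%:R (v ord_max)%:R)).
rewrite p0 meval0 => /esym E; rewrite -[RHS]E /mpoly_at; congr (_%:C); apply: meval_eq => i.
by rewrite mxE; case: (ord2P i) => ->.
Qed.

(** The change of variables is linear homogeneous, so it preserves degrees. *)
Lemma mdeg_mcomplex p m : m \in msupp (mcomplex p) -> (mdeg m < msize p)%N.
Proof.
rewrite mcomplexE => /msupp_sum_le /flattenP[s /mapP[m' m'p ->]] /msuppZ_le ms.
rewrite filter_predT in m'p.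
apply: leq_trans (msize_mdeg_lt m'p); rewrite ltnS.
have H i : @xy_of_zzbar R i \is (ishomog1 1 mdeg).
  have HX j : mpolyX C (mnm1 j) \is (ishomog1 1 mdeg) by rewrite dhomogX /= mdeg1.
  by case: (ord2P i) => ->; rewrite /xy_of_zzbar /=; apply: dhomogZ;
    apply: dhomogD; rewrite ?dhomogN; exact: HX.
move: ms; rewrite big_ord_recr big_ord1 /= => ms.
have /dhomogP := dhomogM (dhomogMn (m' (widen_ord (leqnSn 1) ord0)) (H (widen_ord (leqnSn 1) ord0)))
   (dhomogMn (m' ord_max) (H ord_max)).
move=> /(_ _ ms); rewrite /= !mul1n => ->.
by rewrite mdegE big_ord_recr big_ord1.
Qed.

(** A real polynomial is fixed by conjugating coefficients and exchanging [z] and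
    [conj z]. *)
Lemma mcoeff_mcomplex_swap p a b :
  mcoeff (mono2 b a) (mcomplex p) = conjc (mcoeff (mono2 a b) (mcomplex p)).
Proof.
set q := mcomplex p.
pose q' : mpoly 2 C := \sum_(m <- msupp q) conjc (mcoeff m q) *: mpolyX C (mono2 (m ord_max) (m ord0)).
have q'E : q = q'.
  apply/eqP; rewrite -subr_eq0; apply/eqP/mpoly_eq0_zzbar => z.
  have qR : meval (zzbar z) q = conjc (meval (zzbar z) q).
    by rewrite -[z]ofCK meval_mcomplex conjc_real.
  have zc0 : conjc (zzbar z ord0) = zzbar z ord_max by [].
  rewrite mevalB qR mevalE /q' !rmorph_sum -sumrB big1// => m _.
  rewrite [X in _ - X](_ : _ =
      conjc (mcoeff m q) * (zzbar z ord0 ^+ m ord_max * zzbar z ord_max ^+ m ord0)); last first.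
    by rewrite /= mevalZ meval2X.
  rewrite -mevalX meval2X; move: (zzbar z ord0) (zzbar z ord_max) zc0 => u _ <-.
  by rewrite !rmorphM !rmorphXn /= conjcK [X in _ - _ * X]mulrC subrr.
rewrite {1}q'E /q' raddf_sum /=.
under eq_bigr do rewrite mcoeffZ mcoeffX.
have E (m : multinom 2) : (mono2 (m ord_max) (m ord0) == mono2 b a) = (m == mono2 a b).
  apply/eqP/eqP => [/mnmP E|->//].
  by rewrite [m]mono2E; congr mono2; [exact: (E ord_max)|exact: (E ord0)].
under eq_bigr do rewrite E.
have [mq|mq] := boolP (mono2 a b \in msupp q).
  rewrite (bigD1_seq _ mq) ?msupp_uniq//= eqxx mulr1 big1 ?addr0// => m' /negPf ->.
  by rewrite mulr0.
rewrite (memN_msupp_eq0 mq) conjc0 big_seq big1// => m' m'q.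
case: eqP => [mm|_]; last by rewrite mulr0.
by rewrite -mm m'q in mq.
Qed.
End ComplexPolynomials.

Section PlaneMaps.
Variable R : realType.
Local Notation C := R[i].
Implicit Types (x : 'cV[R]_2) (z w : C) (b : bool).

Lemma toC_inj : injective (@toC R).
Proof. exact: can_inj (@toCK R). Qed.

Lemma toCZ (t : R) x : toC (t *: x) = t%:C * toC x.
Proof. by apply/eqP; rewrite eq_complex /toC /= !mxE; simpc. Qed.

Lemma toC0 : toC (0 : 'cV[R]_2) = 0.
Proof. by apply/eqP; rewrite eq_complex /toC /= !mxE; simpc. Qed.

Definition cj b z := if b then conjc z else z.

Lemma cjM b z w : cj b (z * w) = cj b z * cj b w.
Proof. by case: b => //=; rewrite rmorphM. Qed.

Lemma cj_cj b b' z : cj b (cj b' z) = cj (b (+) b') z.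
Proof. by case: b; case: b' => //=; rewrite conjcK. Qed.

(** The real-linear maps [z |-> w z] and [z |-> w conj z]. *)
Definition mxC w b : 'M[R]_2 :=
  \matrix_(i, j) ofC (w * cj b (if j == ord0 then 1 else 'i%C)) i ord0.

Lemma big_ord2 (V : nmodType) (F : 'I_2 -> V) : \sum_j F j = F ord0 + F ord_max.
Proof. by rewrite big_ord_recr big_ord1 /=; congr (F _ + _); exact: val_inj. Qed.

Lemma toC_mxC w b x : toC (mxC w b *m x) = w * cj b (toC x).
Proof.
apply/eqP; rewrite eq_complex /toC /= !mxE !big_ord2 !mxE /=.
have E1 : cj b 1 = 1 by case: (b) => //=; exact: conjc1.
rewrite E1 mulr1; case: w => u v; case: (b) => /=; apply/andP; split; apply/eqP; ring.
Qed.

Lemma mx_ext (A B : 'M[R]_2) : (forall x, A *m x = B *m x) -> A = B.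
Proof.
move=> AB; apply/matrixP => i j.
have := AB (delta_mx j ord0) => /matrixP/(_ i ord0); rewrite -!colE !mxE//.
Qed.

Lemma mxCM w b w' b' : mxC w b *m mxC w' b' = mxC (w * cj b w') (b (+) b').
Proof.
apply: mx_ext => x; apply: toC_inj.
by rewrite -mulmxA !toC_mxC cjM cj_cj mulrA.
Qed.

Lemma mxC1 : mxC 1 false = 1%:M.
Proof. by apply: mx_ext => x; apply: toC_inj; rewrite toC_mxC mul1mx mul1r. Qed.

Lemma mxC_inj w b w' b' : w != 0 -> mxC w b = mxC w' b' -> w = w' /\ b = b'.
Proof.
move=> w0 E.
have H z : w * cj b z = w' * cj b' z by rewrite -[z]ofCK -!toC_mxC E.
have ww : w = w'.
  by have := H 1; rewrite /cj; case: (b) (b') => -[]; rewrite ?conjc1 !mulr1.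
split=> //; move: (H 'i%C); rewrite -ww => /(mulfI w0).
have : 'i%C != - 'i%C :> C by rewrite -subr_eq0 opprK -mulr2n mulrn_eq0 /= complexiE neq0Ci.
by move=> /eqP ii; case: b b' {E H} => -[] //=; simpc; move=> E'; case: ii; rewrite -?E' //; simpc.
Qed.

Lemma mxC_unit w b : w != 0 -> mxC w b \in unitmx.
Proof.
move=> w0; have := mxCM w b (cj b w^-1) b.
rewrite cj_cj addbb divff// mxC1 => /mulmx1_unit[] //.
Qed.

Lemma toC_vfunE (Q : ratVField R 2) x : vdom Q x ->
  toC (vfun Q x) * (mpoly_at (vden Q) x)%:C =
  (mpoly_at (vnum Q ord0) x)%:C + 'i%C * (mpoly_at (vnum Q ord_max) x)%:C.
Proof.
move=> Dx; apply/eqP; rewrite eq_complex /toC /= !mxE; simpc.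
by rewrite !divfK ?eqxx.
Qed.

Lemma invariant_unitE (G : set 'M[R]_2) g (Q : ratVField R 2) : G g -> g \in unitmx ->
  invariant_under G Q -> forall x, vdom Q x -> vdom Q (g *m x) ->
  vfun Q (g *m x) = g *m vfun Q x.
Proof. by move=> Gg gU QG x Qx Qgx; rewrite -(QG _ Gg _ Qx Qgx) mulKVmx. Qed.

Lemma vdom_neq0 (Q : ratVField R 2) x : vdom Q x -> (mpoly_at (vden Q) x)%:C != 0 :> C.
Proof. by move=> Qx; rewrite eq_complex /= eqxx andbT. Qed.
End PlaneMaps.

(** * Fields invariant under a rotation *)

Section RotationCovariance.
Variable R : realType.
Local Notation C := R[i].
Implicit Types (x : 'cV[R]_2) (z w : C) (Q : ratVField R 2).

Definition zden Q : mpoly 2 C := mcomplex (vden Q).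
Definition znum Q : mpoly 2 C :=
  mcomplex (vnum Q ord0) + 'i%C *: mcomplex (vnum Q ord_max).

Lemma meval_zden Q x : meval (zzbar (toC x)) (zden Q) = (mpoly_at (vden Q) x)%:C.
Proof. exact: meval_mcomplex. Qed.

Lemma meval_znum Q x : vdom Q x ->
  meval (zzbar (toC x)) (znum Q) = toC (vfun Q x) * (mpoly_at (vden Q) x)%:C.
Proof.
move=> Qx; rewrite toC_vfunE// /znum mevalD mevalZ.
by congr (_ + _ * _); exact: meval_mcomplex.
Qed.

Lemma zden_neq0 Q : zden Q != 0.
Proof. by apply: contra_neq (vden_neq0 Q); exact: mcomplex_eq0. Qed.

Lemma meval_zzbar_mscale t w z (q : mpoly 2 C) : conjc t = t -> conjc w = w^-1 ->
  meval (zzbar z) (mscale (t * w) (t * w^-1) q) = meval (zzbar (t * w * z)) q.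
Proof.
move=> tR wc; rewrite meval_mscale; apply: meval_eq => i; rewrite /zzbar.
by case: (i == ord0); rewrite // !rmorphM /= tR wc.
Qed.

Lemma vdom_zden Q x : vdom Q x <-> meval (zzbar (toC x)) (zden Q) != 0.
Proof. by rewrite meval_zden eq_complex /= eqxx andbT. Qed.

(** The factor 2 in the homogeneity makes total degrees visible in the eigenvalues of the
    substitution [z |-> 2 w z]; any positive factor other than 1 would do. *)
Lemma rotation_covariant_eval w Q (G : set 'M[R]_2) x : w != 0 -> G (mxC w false) ->
  homogeneous2 Q -> invariant_under G Q ->
  meval (zzbar (toC x)) (zden Q) != 0 ->
  meval (zzbar (w * toC x)) (zden Q) != 0 ->
  meval (zzbar (2 * w * toC x)) (zden Q) != 0 ->
  meval (zzbar (2 * w * toC x)) (znum Q) * meval (zzbar (toC x)) (zden Q) =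
  4 * w * (meval (zzbar (toC x)) (znum Q) * meval (zzbar (2 * w * toC x)) (zden Q)).
Proof.
move=> w0 Gw Qh QG; pose y := mxC w false *m x.
have wxE : w * toC x = toC y by rewrite toC_mxC.
have -> : 2 * w * toC x = toC (2 *: y) by rewrite toCZ -wxE mulrA rmorph_nat.
rewrite wxE => /vdom_zden Qx /vdom_zden Qy /vdom_zden Q2y.
have FE : toC (vfun Q (2 *: y)) = 4 * w * toC (vfun Q x).
  rewrite (Qh 2 _ Qy Q2y) (invariant_unitE Gw (mxC_unit _ w0) QG Qx Qy) toCZ toC_mxC.
  by rewrite rmorphXn rmorph_nat [cj _ _]/= mulrA -natrX.
move: (meval_znum Qx) (meval_znum Q2y) (meval_zden Q x) (meval_zden Q (2 *: y)).
move=> /(congr1 (fun a => 4 * w * (a * meval (zzbar (toC (2 *: y))) (zden Q)))) Ex.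
move=> /(congr1 (fun a => a * meval (zzbar (toC x)) (zden Q))) E2y Dx D2y.
apply: etrans E2y (esym (etrans Ex _)).
clear Ex; move: Dx D2y FE.
move: (meval (zzbar (toC x)) _) (meval (zzbar (toC (2 *: y))) _) => d d2.
move: (toC (vfun Q x)) (toC (vfun Q (2 *: y))) => f f2 -> -> ->.
by rewrite !mulrA mulrAC.
Qed.

Lemma mscale_covariant w u l0 l1 (p D : mpoly 2 C) :
  w != 0 -> u = w^-1 -> conjc w = w^-1 -> l0 = 2 * w -> l1 = 2 * u -> D != 0 ->
  (forall z, meval (zzbar z) D != 0 -> meval (zzbar (w * z)) D != 0 ->
     meval (zzbar (l0 * z)) D != 0 ->
     meval (zzbar (l0 * z)) p * meval (zzbar z) D =
     4 * w * (meval (zzbar z) p * meval (zzbar (l0 * z)) D)) ->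
  mscale l0 l1 p * D = (4 * w) *: (p * mscale l0 l1 D).
Proof.
move=> w0 uE wc l0E l1E D0 H.
have two0 : 2 != 0 :> C by rewrite pnatr_eq0.
have u0 : u != 0 by rewrite uE invr_eq0.
have l00 : l0 != 0 by rewrite l0E mulf_neq0.
have l10 : l1 != 0 by rewrite l1E mulf_neq0.
have sc1 q z : meval (zzbar z) (mscale w u q) = meval (zzbar (w * z)) q.
  by have := meval_zzbar_mscale z q (conjc1 _) wc; rewrite !mul1r uE.
have sc2 q z : meval (zzbar z) (mscale l0 l1 q) = meval (zzbar (l0 * z)) q.
  by rewrite l1E uE l0E; apply: meval_zzbar_mscale => //; rewrite conjc_nat.
(* The hypothesis holds off the zeros of these three denominators only. *)
have A0 : D * mscale w u D * mscale l0 l1 D != 0.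
  by rewrite !mulf_neq0 ?mscale_neq0.
apply/eqP; rewrite -subr_eq0; apply/eqP/(mulIf A0); rewrite mul0r.
apply: mpoly_eq0_zzbar => z.
move: (sc1 D z) (sc2 p z) (sc2 D z) (H z).
move: (mscale w u D) (mscale l0 l1 p) (mscale l0 l1 D) => Dw pl Dl Ew Ep El.
rewrite -Ew -Ep -El => {}H; rewrite mevalM mevalB mevalZ !mevalM; move: H.
move: (meval (zzbar z) D) (meval (zzbar z) Dw) (meval (zzbar z) Dl) => d d1 d2 H.
have [->|d0] := eqVneq d 0; first by rewrite !mul0r mulr0.
have [->|d10] := eqVneq d1 0; first by rewrite mulr0 mul0r mulr0.
have [->|d20] := eqVneq d2 0; first by rewrite !mulr0.
by rewrite H// subrr mul0r.
Qed.

Lemma rotation_covariant_field n w Q (G : set 'M[R]_2) :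
  n.-primitive_root w -> conjc w = w^-1 -> `|w| = 1 -> odd n -> G (mxC w false) ->
  homogeneous2 Q -> invariant_under G Q -> (den_degree Q + 3 <= n)%N ->
  (forall x, vdom Q x -> vfun Q x = 0) \/
  exists2 k, n = k.*2.+3 & exists c, forall x, vdom Q x ->
    toC (vfun Q x) * (toC x * conjc (toC x)) ^+ k = c * conjc (toC x) ^+ n.-1.
Proof.
move=> wP wc w1 n_odd Gw Qh QG Qn.
have w0 : w != 0 by rewrite -normr_eq0 w1 oner_neq0.
have [p0|p0] := eqVneq (znum Q) 0.
  left=> x Qx; apply: toC_inj; rewrite toC0; apply/eqP.
  have /eqP := meval_znum Qx; rewrite p0 meval0 eq_sym mulf_eq0 => /orP[//|].
  by rewrite (negPf (vdom_neq0 Qx)).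
right.
have Dle nu : nu \in msupp (zden Q) -> (mdeg nu <= den_degree Q)%N.
  by move=> /mdeg_mcomplex; rewrite /den_degree; case: (msize _).
have Dsym a b : mono2 a b \in msupp (zden Q) -> mono2 b a \in msupp (zden Q).
  by rewrite !mcoeff_msupp [mcoeff (mono2 b a) _]mcoeff_mcomplex_swap conjc_eq0.
have E : mscale (2 * w) (2 * w^-1) (znum Q) * zden Q =
    (4 * w) *: (znum Q * mscale (2 * w) (2 * w^-1) (zden Q)).
  apply: (mscale_covariant w0 erefl wc erefl erefl (zden_neq0 Q)) => z.
  by rewrite -[z]ofCK; exact: (rotation_covariant_eval w0 Gw Qh QG).
have [k nk [c cE]] := rational_covariant wP w1 n_odd (zden_neq0 Q) p0 Qn Dle Dsym E.
exists k => //; exists c => x Qx.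
apply: (mulIf (vdom_neq0 Qx)).
have := congr1 (meval (zzbar (toC x))) cE; clear E.
rewrite mevalZ !mevalM !meval2X (meval_znum Qx) (meval_zden Q x) /= mul1r -exprMn => E.
by rewrite mulrAC E mulrA.
Qed.
End RotationCovariance.

(** * The dihedral field *)

Section BaseField.
Variables (R : realType) (k : nat).
Local Notation C := R[i].
Local Notation m := (k.*2.+3).
Implicit Types (x : 'cV[R]_2) (z w : C) (Q : ratVField R 2).

Lemma mpoly_at_neq0 n (p : mpoly n R) : p != 0 -> exists x : 'cV[R]_n, mpoly_at p x != 0.
Proof.
move=> p0; apply: contrapT => nex; move/eqP: p0; apply; apply: mpoly_eq0_nat => v.
apply: contrapT => /eqP v0; apply: nex; exists (\col_i (v i)%:R).
by rewrite /mpoly_at (_ : meval _ p = meval (fun i => (v i)%:R) p)//; apply: meval_eq => i; rewrite mxE.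
Qed.

Let X : mpoly 2 R := mpolyX R (mnm1 ord0).
Let Y : mpoly 2 R := mpolyX R (mnm1 ord_max).

(** Real and imaginary parts of [conj z ^+ n]. *)
Fixpoint conj_pow n : mpoly 2 R * mpoly 2 R :=
  if n is n'.+1 then
    let: (A, B) := conj_pow n' in (X * A + Y * B, X * B - Y * A)
  else (1, 0).

Lemma mpoly_atX x : mpoly_at X x = x ord0 ord0. Proof. exact: mevalXU. Qed.
Lemma mpoly_atY x : mpoly_at Y x = x ord_max ord0. Proof. exact: mevalXU. Qed.

Lemma conj_powE n x :
  Complex (mpoly_at (conj_pow n).1 x) (mpoly_at (conj_pow n).2 x) = conjc (toC x) ^+ n.
Proof.
elim: n => [|n IHn]; first by rewrite /mpoly_at /= meval1 meval0.
rewrite exprS -IHn /=; case: (conj_pow n) => A B /=.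
rewrite /mpoly_at mevalB mevalD !mevalM -!/(mpoly_at _ x) mpoly_atX mpoly_atY /toC; by simpc.
Qed.

Lemma mcomplex_conj_pow n : mcomplex (conj_pow n).1 + 'i%C *: mcomplex (conj_pow n).2 =
  mpolyX C (mnm1 ord_max) ^+ n.
Proof.
apply/eqP; rewrite -subr_eq0; apply/eqP; apply: mpoly_eq0_zzbar => z.
rewrite -[z]ofCK mevalB mevalD mevalZ rmorphXn /= mevalXU.
rewrite -[zzbar _ _]/(conjc (toC _)) -conj_powE.
move: (meval_mcomplex (conj_pow n).1 (ofC z)) (meval_mcomplex (conj_pow n).2 (ofC z)).
move: (meval _ (mcomplex (conj_pow n).1)) (meval _ (mcomplex (conj_pow n).2)).
move=> a b -> ->.
by apply/eqP; rewrite subr_eq0 eq_complex /=; simpc.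
Qed.

Definition base_num (i : 'I_2) : mpoly 2 R :=
  if i == ord0 then (conj_pow m.-1).1 else (conj_pow m.-1).2.
Definition base_den : mpoly 2 R := (X ^+ 2 + Y ^+ 2) ^+ k.

Lemma base_denE x : (mpoly_at base_den x)%:C = (toC x * conjc (toC x)) ^+ k.
Proof.
rewrite /mpoly_at /base_den rmorphXn rmorphXn /=; congr (_ ^+ _).
rewrite mevalD !rmorphXn /= -!/(mpoly_at _ x) mpoly_atX mpoly_atY /toC.
by apply/eqP; rewrite eq_complex /=; apply/andP; split; apply/eqP; ring.
Qed.

Lemma base_den_neq0 : base_den != 0.
Proof.
rewrite expf_neq0//; apply/negP => /eqP E.
have := congr1 (fun p => mpoly_at p (ofC 1)) E.
rewrite /mpoly_at mevalD !rmorphXn /= !mevalXU meval0 !mxE /= expr0n addr0 expr1n.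
by move/eqP; rewrite oner_eq0.
Qed.

Lemma msize_base_den : (msize base_den <= k.*2.+1)%N.
Proof.
have HX (j : 'I_2) : mpolyX R (mnm1 j) \is (ishomog1 1 mdeg) by rewrite dhomogX /= mdeg1.
have H : base_den \is (ishomog1 (2 * k) mdeg).
  by apply: dhomogMn; apply: dhomogD; exact: (dhomogMn 2 (HX _)).
rewrite msizeE; apply/bigmax_leqP_seq => nu nuD _.
by move/dhomogP: H => /(_ _ nuD); rewrite mul2n /= => ->.
Qed.

Lemma mcomplexM (p q : mpoly 2 R) : mcomplex (p * q) = mcomplex p * mcomplex q.
Proof. by rewrite mcomplex.unlock rmorphM. Qed.

Lemma mcomplexB (p q : mpoly 2 R) : mcomplex (p - q) = mcomplex p - mcomplex q.
Proof. by rewrite mcomplex.unlock raddfB. Qed.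

Lemma mcomplexC (c : R) : mcomplex (mpolyC 2 c) = mpolyC 2 c%:C.
Proof. by rewrite mcomplex.unlock mmapC. Qed.

Lemma mcomplex_conj_powV n : mcomplex (conj_pow n).1 - 'i%C *: mcomplex (conj_pow n).2 =
  mpolyX C (mnm1 ord0) ^+ n.
Proof.
apply/eqP; rewrite -subr_eq0; apply/eqP; apply: mpoly_eq0_zzbar => z.
rewrite -[z]ofCK mevalB mevalB mevalZ rmorphXn /= mevalXU.
have -> : zzbar (toC (ofC z)) ord0 ^+ n =
    conjc (Complex (mpoly_at (conj_pow n).1 (ofC z)) (mpoly_at (conj_pow n).2 (ofC z))).
  by rewrite conj_powE rmorphXn -[zzbar _ _]/(toC _) -{1}[toC _]conjcK.
move: (meval_mcomplex (conj_pow n).1 (ofC z)) (meval_mcomplex (conj_pow n).2 (ofC z)).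
move: (meval _ (mcomplex (conj_pow n).1)) (meval _ (mcomplex (conj_pow n).2)).
move=> a b -> ->.
by apply/eqP; rewrite subr_eq0 eq_complex /=; simpc.
Qed.

(** Over an algebraically closed field a nonconstant polynomial in one variable has a root,
    so [q] is constant on every line [X_0 = a] and [X_1 = b] with [a, b] nonzero; any two
    points with nonzero first coordinate are joined by such lines. *)
Lemma mpoly_no_zero_cst (q : mpoly 2 C) :
  (forall v : 'I_2 -> C, (v ord0 != 0) || (v ord_max != 0) -> meval v q != 0) ->
  exists c, q = mpolyC 2 c.
Proof.
pose v2 (a b : C) (i : 'I_2) := if i == ord0 then a else b.
move=> q0; pose f a b := meval (v2 a b) q.
have cst (h : 'I_2 -> {poly C}) :
    (forall b, meval (fun i => (h i).[b]) q != 0) ->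
    forall b b', meval (fun i => (h i).[b]) q = meval (fun i => (h i).[b']) q.
  pose P := \sum_(m <- msupp q) (mcoeff m q) *: \prod_i h i ^+ m i.
  have PE b : P.[b] = meval (fun i => (h i).[b]) q.
    rewrite mevalE horner_sum; apply: eq_bigr => m _.
    by rewrite hornerZ horner_prod; congr (_ * _); apply: eq_bigr => i _; rewrite horner_exp.
  move=> H b b'; rewrite -!PE.
  have : size P == 1.
    apply: contraT => /closed_rootP[r /rootP]; rewrite PE => /eqP.
    by rewrite (negPf (H r)).
  by case/size_poly1P => c _ ->; rewrite !hornerC.
have fr a b b' : a != 0 -> f a b = f a b'.
  move=> a0; pose h (i : 'I_2) : {poly C} := if i == ord0 then a%:P else 'X.
  have hE c : f a c = meval (fun i => (h i).[c]) q.
    by apply: meval_eq => i; rewrite /v2 /h; case: ifP; rewrite ?hornerC ?hornerX.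
  by rewrite !hE; apply: cst => c; apply: q0; rewrite /h /= hornerC a0.
have fl a a' b : b != 0 -> f a b = f a' b.
  move=> b0; pose h (i : 'I_2) : {poly C} := if i == ord0 then 'X else b%:P.
  have hE c : f c b = meval (fun i => (h i).[c]) q.
    by apply: meval_eq => i; rewrite /v2 /h; case: ifP; rewrite ?hornerC ?hornerX.
  by rewrite !hE; apply: cst => c; apply: q0; rewrite /h /= hornerC b0 orbT.
have f1 a b : a != 0 -> f a b = f 1 1.
  by move=> a0; rewrite (fr _ _ 1)// (fl _ 1)// oner_neq0.
exists (f 1 1); apply/eqP; rewrite -subr_eq0.
have : (q - mpolyC 2 (f 1 1)) * mpolyX C (mnm1 ord0) == 0.
  apply/eqP/mpoly_eq0_nat => v.
  rewrite mevalM mevalB mevalC mevalXU.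
  have [->|v0] := eqVneq (v ord0)%:R (0 : C); first by rewrite mulr0.
  rewrite -(f1 _ (v ord_max)%:R v0) (_ : meval _ q = f (v ord0)%:R (v ord_max)%:R) ?subrr ?mul0r//.
  by apply: meval_eq => i; case: (ord2P i) => ->.
rewrite mulf_eq0 => /orP[//|/eqP/(congr1 (mcoeff (mnm1 ord0)))/eqP].
by rewrite mcoeffX eqxx mcoeff0 oner_eq0.
Qed.

End BaseField.

Section BaseSuperfield.
Variables (R : realType) (k : nat).
Local Notation C := R[i].
Local Notation m := (k.*2.+3).
Implicit Types (x : 'cV[R]_2) (z w : C) (Q : ratVField R 2).

Lemma conjcM z w : conjc (z * w) = conjc z * conjc w.
Proof. exact: rmorphM. Qed.

Lemma conjcX z n : conjc (z ^+ n) = conjc z ^+ n.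
Proof. exact: rmorphXn. Qed.

(** A common divisor of the real and imaginary parts of [conj z ^ n] divides both
    [conj z ^ n] and [z ^ n], so as a polynomial in [z] and [conj z] it vanishes at most at
    the origin. *)
Lemma conj_pow_coprime n (G : mpoly 2 R) : (0 < n)%N ->
  (exists A, (conj_pow R n).1 = A * G) -> (exists B, (conj_pow R n).2 = B * G) ->
  G \is a GRing.unit.
Proof.
move=> n0 [A AE] [B BE].
have div1 : mpolyX C (mnm1 ord_max) ^+ n = (mcomplex A + 'i%C *: mcomplex B) * mcomplex G.
  by rewrite -mcomplex_conj_pow AE BE !mcomplexM mulrDl scalerAl.
have div0 : mpolyX C (mnm1 ord0) ^+ n = (mcomplex A - 'i%C *: mcomplex B) * mcomplex G.
  by rewrite -mcomplex_conj_powV AE BE !mcomplexM mulrBl scalerAl.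
have mevalXn v (p : mpoly 2 C) : meval v (p ^+ n) = meval v p ^+ n by exact: rmorphXn.
move: div1 div0; move: (mcomplex A + _) (mcomplex A - _) => A1 A0 div1 div0.
have [c cE] : exists c, mcomplex G = mpolyC 2 c.
  apply: mpoly_no_zero_cst => v; apply: contraTneq => G0.
  have v1 : v ord_max ^+ n == 0 by rewrite -(mevalXU v) -mevalXn div1 mevalM G0 mulr0.
  have v0 : v ord0 ^+ n == 0 by rewrite -(mevalXU v) -mevalXn div0 mevalM G0 mulr0.
  by rewrite !expf_eq0 !n0 /= in v0 v1; rewrite v0 v1.
have cR : c = (mpoly_at G 0)%:C.
  by rewrite -(meval_mcomplex G 0) cE mevalC.
have GE : G = mpolyC 2 (mpoly_at G 0).
  by apply/eqP; rewrite -subr_eq0; apply/eqP/mcomplex_eq0; rewrite mcomplexB mcomplexC cE cR subrr.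
rewrite GE; apply: rmorph_unit; rewrite unitfE.
apply: contra_neq (oner_neq0 C) => G0.
have := congr1 (meval (fun=> 1)) div1.
by rewrite cE mevalM mevalC cR G0 mulr0 mevalXn mevalXU expr1n.
Qed.

Lemma base_reduced (G : mpoly 2 R) :
  (forall i, exists A, base_num R k i = A * G) ->
  (exists B, base_den R k = B * G) -> G \is a GRing.unit.
Proof. by move=> Gn _; apply: (@conj_pow_coprime m.-1); [|exact: (Gn ord0)|exact: (Gn ord_max)]. Qed.

Definition base_field : ratVField R 2 :=
  RatVField (base_den_neq0 R k) base_reduced.

Lemma toC_base_field x : vdom base_field x ->
  toC (vfun base_field x) * (toC x * conjc (toC x)) ^+ k = conjc (toC x) ^+ m.-1.
Proof.
move=> Qx; rewrite -base_denE -[base_den _ _]/(vden base_field) toC_vfunE//.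
rewrite -conj_powE; apply/eqP; rewrite eq_complex /=; by simpc.
Qed.

Lemma vdom_base_field x : vdom base_field x -> (toC x * conjc (toC x)) ^+ k != 0.
Proof. by move=> Qx; rewrite -base_denE; exact: (vdom_neq0 Qx). Qed.

Lemma base_field_nonzero : vnonzero base_field.
Proof.
exists ord0; apply/eqP => /(congr1 (fun p => mpoly_at p (ofC 1))).
have := conj_powE m.-1 (ofC 1 : 'cV[R]_2); rewrite ofCK conjc1 expr1n => -[E _].
by rewrite {2}/mpoly_at meval0 /= /base_num /= E => /eqP; rewrite oner_eq0.
Qed.

Lemma base_field_homogeneous : homogeneous2 base_field.
Proof.
move=> t x Qx Qtx; apply: toC_inj; apply: (mulIf (vdom_base_field Qtx)).
have conjZ : conjc (toC (t *: x)) = t%:C * conjc (toC x).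
  by rewrite toCZ conjcM conjc_real.
have tX : (t ^+ 2)%:C = t%:C ^+ 2 by rewrite rmorphXn.
rewrite (toC_base_field Qtx) conjZ !toCZ exprMn -(toC_base_field Qx) tX.
move: t%:C (toC x) (toC (vfun _ x)) => T z f.
have -> : T * z * (T * conjc z) = T ^+ 2 * (z * conjc z) by rewrite expr2 mulrACA.
have -> : T ^+ m.-1 = T ^+ 2 * T ^+ 2 ^+ k by rewrite -exprM -exprD; congr (_ ^+ _); lia.
move: (T ^+ 2) (z * conjc z) => T2 z2; rewrite [(T2 * z2) ^+ k]exprMn.
by rewrite -!mulrA; congr (_ * _); rewrite mulrCA.
Qed.

Lemma base_field_invariant w b x : conjc w = w^-1 -> w ^+ m = 1 ->
  vdom base_field x -> vdom base_field (mxC w b *m x) ->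
  vfun base_field (mxC w b *m x) = mxC w b *m vfun base_field x.
Proof.
move=> wc wm Qx Qwx; apply: toC_inj; apply: (mulIf (vdom_base_field Qwx)).
have w0 : w != 0.
  by apply: contra_eq_neq wm => ->; rewrite expr0n eq_sym oner_neq0.
rewrite toC_base_field// !toC_mxC conjcM wc.
have cjc : conjc (cj b (toC x)) = cj b (conjc (toC x)) by case: (b).
have -> : w * cj b (toC x) * (w^-1 * conjc (cj b (toC x))) = cj b (toC x * conjc (toC x)).
  by rewrite cjM cjc mulrACA divff// mul1r.
have cjX z n : cj b z ^+ n = cj b (z ^+ n) by case: (b) => //=; rewrite conjcX.
rewrite cjX -mulrA -cjM toC_base_field// exprMn cjc cjX; congr (_ * _).
by apply: (mulfI (expf_neq0 m.-1 w0)); rewrite exprVn divff ?expf_neq0// -exprSr.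
Qed.
End BaseSuperfield.

Section BaseMinimal.
Variables (R : realType) (k : nat).
Local Notation C := R[i].
Local Notation m := (k.*2.+3).
Implicit Types (x : 'cV[R]_2) (z w : C) (Q : ratVField R 2).

Lemma reflection_generic_point Q : exists x,
  [/\ vdom Q x, vdom Q (mxC 1 true *m x) & toC x != 0].
Proof.
have D'0 : mscale 1 (-1) (vden Q) != 0.
  by rewrite mscale_neq0 ?oppr_eq0 ?oner_neq0// vden_neq0.
have X0 : mpolyX R (mnm1 (ord0 : 'I_2)) != 0.
  apply/eqP => /(congr1 (mcoeff (mnm1 ord0)))/eqP.
  by rewrite mcoeffX eqxx mcoeff0 oner_eq0.
have [x] := mpoly_at_neq0 (mulf_neq0 (mulf_neq0 (vden_neq0 Q) D'0) X0).
rewrite /mpoly_at !mevalM mevalXU !mulf_eq0 !negb_or => /andP[/andP[Dx D'x] x0].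
exists x; split => //.
  rewrite /vdom /= /mpoly_at; move: D'x; rewrite meval_mscale.
  apply: contraNneq => <-; apply/eqP.
  apply: meval_eq => i.
  have -> : mxC 1 true *m x = ofC (conjc (toC x)) by rewrite -[LHS]toCK toC_mxC mul1r.
  by rewrite mxE; case: (ord2P i) => -> /=; rewrite ?mul1r ?mulN1r.
by rewrite eq_complex /= (negPf x0).
Qed.

(** The rotation determines the field up to a complex factor [c]; evaluating at a point and
    at its conjugate shows that [c] is real. *)
Lemma base_field_minimal w Q (G : set 'M[R]_2) :
  m.-primitive_root w -> conjc w = w^-1 -> `|w| = 1 ->
  G (mxC w false) -> G (mxC 1 true) ->
  homogeneous2 Q -> invariant_under G Q ->
  scalar_multiple Q (base_field R k) \/ (den_degree (base_field R k) < den_degree Q)%N.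
Proof.
move=> wP wc w1 Gw Gc Qh QG.
have [ltD|leD] := ltnP (den_degree (base_field R k)) (den_degree Q); first by right.
left.
have Qm : (den_degree Q + 3 <= m)%N.
  move: leD; rewrite /den_degree; have := msize_base_den R k.
  by rewrite -/(vden (base_field R k)) [vden (base_field R k)]/=; lia.
have m_odd : odd m by rewrite /= negbK odd_double.
have [Q0|[k' k'E [c cE]]] := rotation_covariant_field wP wc w1 m_odd Gw Qh QG Qm.
  by exists 0 => x _ Qx; rewrite Q0// scale0r.
have {k'E} k'k : k' = k by lia.
rewrite {k'}k'k in cE.
have [x [Qx Qcx x0]] := reflection_generic_point Q.
have cR : conjc c = c.
  have gU : (mxC 1 true : 'M[R]_2) \in unitmx by rewrite mxC_unit// oner_neq0.
  move: {Qm m_odd wP leD} (m.-1) cE => n cE.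
  have := cE _ Qcx; rewrite (invariant_unitE Gc gU QG Qx Qcx) !toC_mxC !mul1r.
  have := congr1 (@conjc R) (cE _ Qx); rewrite !conjcM !conjcX !conjcM conjcK.
  rewrite /cj => -> H; apply: (mulIf _ H).
  by rewrite expf_neq0.
have [r rE] : exists r, c = r%:C.
  exists (complex.Re c); apply/eqP; rewrite eq_complex /= eqxx /=.
  by case: (c) cR => a b [] /eqP; rewrite eq_sym -addr_eq0 -mulr2n mulrn_eq0 /=.
exists r => y By Qy; apply: toC_inj; apply: (mulIf (vdom_base_field By)).
by rewrite toCZ -mulrA toC_base_field// cE// rE.
Qed.
End BaseMinimal.

(** * Primitives and separation of variables *)

Section Primitive.
Variable R : realType.
Local Notation mu := (@lebesgue_measure R).
Local Open Scope classical_set_scope.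

(** The integral from 0 to [x]; the difference of two integrals over half-open intervals
    covers both signs of [x]. *)
Lemma continuous_primitive (f : R -> R) : continuous f ->
  exists F : R -> R, forall x : R, is_derive x (1 : R) F (f x).
Proof.
move=> fc.
have fint (a b : R) : mu.-integrable `[a, b] (EFin \o f).
  apply: continuous_compact_integrable; first exact: segment_compact.
  exact: continuous_subspaceT.
pose I (A : set R) := Rintegral mu A f.
pose F x := I `]0, x] - I `]x, 0].
exists F => x0.
pose a := - (`|x0| + 1); pose b := `|x0| + 1.
have h1 := ler_norm x0.
have h2 : - `|x0| <= x0 by rewrite lerNl -normrN ler_norm.
have h0 := normr_ge0 x0.
have [ax0 a0] : a < x0 /\ a < 0 by rewrite /a; split; lra.
have [x0b b0] : x0 < b /\ 0 < b by rewrite /b; split; lra.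
(* Near [x0] this primitive is, up to a constant, the integral from a point [a] on the
   left of both [x0] and 0. *)
have FE x : a < x -> F x = I `[a, x] - I `[a, 0].
  move=> ax; rewrite /F /I; have [x_le0|/ltW x_ge0] := leP x 0.
    rewrite [X in X - _](_ : _ = 0); last by rewrite set_itv_ge ?Rintegral_set0// bnd_simp -leNgt.
    rewrite sub0r -(@Rintegral_itvB _ f (BLeft a) (BRight 0) x) ?opprB//.
    by rewrite bnd_simp ltW.
  rewrite [X in _ - X](_ : _ = 0); last by rewrite set_itv_ge ?Rintegral_set0// bnd_simp -leNgt.
  by rewrite subr0 -(@Rintegral_itvB _ f (BLeft a) (BRight x) 0)// bnd_simp ltW.
have [dI dIE] := @continuous_FTC1_closed R f a x0 b x0b (fint a b) ax0 (fc x0).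
apply: (@near_eq_is_derive _ _ _ (fun x => I `[a, x] - I `[a, 0])).
- near=> x; rewrite FE//.
  by near: x; exact: lt_nbhsr.
- rewrite -[f x0]subr0; apply: is_deriveB.
  by rewrite -dIE derive1E; exact: DeriveDef.
Unshelve. all: by end_near. Qed.
End Primitive.

Section TimeFunction.
Variable R : realType.
Local Open Scope classical_set_scope.

(** The autonomous equation [s' = 1 / g s] with [g > 0] is solved by inverting a primitive
    [G] of [g]. The range of [G] need not be the whole line (solutions may escape in finite
    time), hence the local form of [G (H y) = y]. *)
Lemma separation_of_variables (g : R -> R) : continuous g -> (forall s, 0 < g s) ->
  exists G H : R -> R, [/\ cancel G H,
    forall s, is_derive (G s) (1 : R) H (g s)^-1 &
    forall s, \forall y \near G s, G (H y) = y].
Proof.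
move=> gc g0; have [G dG] := continuous_primitive gc.
have Gc : continuous G.
  by move=> s; apply/differentiable_continuous/derivable1_diffP; exact: (@ex_derive _ _ _ _ _ _ _ (dG s)).
have G_lt x y : x < y -> G x < G y.
  move=> xy; rewrite -subr_gt0.
  have [|c _ ->] := MVT xy (fun z _ => dG z).
    by apply: continuous_subspaceT.
  by rewrite mulr_gt0// subr_gt0.
have GI : injective G.
  move=> x y E; apply/eqP; rewrite eq_le !leNgt; apply/andP; split; apply/negP => /G_lt;
    by rewrite E ltxx.
pose H y := xget 0 [set s | G s = y].
have GH : cancel G H.
  by move=> s; apply: GI; exact: (@xgetPex _ 0 [set s' | G s' = G s] (ex_intro _ s erefl)).
have nGH (s : R) : {near s, cancel G H} by apply: filterE => x; exact: GH.
have nGc (s : R) : {near s, continuous G} by apply: filterE => x; exact: Gc.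
exists G, H; split => // s.
  by apply: (is_derive_inverse (nGH s) (nGc s) (dG s)); rewrite gt_eqF.
exact: near_continuous_can_sym.
Unshelve. all: by end_near. Qed.
End TimeFunction.

(** * The orbit curves *)

Section RootBranch.
Variables (R : realType) (m : nat).
Hypothesis m_gt0 : (0 < m)%N.
Local Notation C := R[i].
Local Notation M := (m%:R : R).
Local Open Scope classical_set_scope.
Implicit Types (s t : R).

Let M0 : M != 0. Proof. by rewrite pnatr_eq0 -lt0n. Qed.

Lemma one_sqr_gt0 s : 0 < 1 + s ^+ 2.
Proof. by rewrite ltr_pwDl// sqr_ge0. Qed.

(** [branch] is the principal branch of [(1 - i s) ^ (1/m)]; its logarithm has real part
    [log_radius s] and imaginary part [- angle s]. *)
Definition log_radius s : R := ln (1 + s ^+ 2) / (2 * M).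
Definition angle s : R := atan s / M.
Definition branch s : C :=
  Complex (expR (log_radius s) * cos (angle s)) (- (expR (log_radius s) * sin (angle s))).

Lemma de_moivre t n : Complex (cos t) (- sin t) ^+ n = Complex (cos (t * n%:R)) (- sin (t * n%:R)).
Proof.
elim: n => [|n IHn]; first by rewrite mulr0 cos0 sin0 oppr0.
rewrite exprS IHn -natr1 mulrDr mulr1 cosD sinD; simpc.
by apply/eqP; rewrite eq_complex /=; apply/andP; split; apply/eqP; ring.
Qed.

Lemma expR_log_radius s : expR (log_radius s) ^+ m = Num.sqrt (1 + s ^+ 2).
Proof.
apply/eqP; rewrite -(eqrXn2 (n := 2))// ?sqrtr_ge0 ?exprn_ge0 ?expR_ge0//.
rewrite sqr_sqrtr ?(ltW (one_sqr_gt0 _))// -!expRM_natr /log_radius.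
have -> : ln (1 + s ^+ 2) / (2 * M) * M * 2 = ln (1 + s ^+ 2) by field.
by rewrite lnK// posrE one_sqr_gt0.
Qed.

Lemma branchE s :
  branch s = (expR (log_radius s))%:C * Complex (cos (angle s)) (- sin (angle s)).
Proof.
by rewrite /branch; apply/eqP; rewrite eq_complex /=; apply/andP; split; apply/eqP; ring.
Qed.

Lemma branchX s : branch s ^+ m = Complex 1 (- s).
Proof.
rewrite branchE exprMn de_moivre /angle divfK// -rmorphXn /= expR_log_radius.
have q0 : Num.sqrt (1 + s ^+ 2) != 0 by rewrite gt_eqF// sqrtr_gt0 one_sqr_gt0.
have -> : sin (atan s) = s * cos (atan s).
  by rewrite -{2}[s]atanK /tan divfK// cos_atan invr_eq0.
rewrite cos_atan; apply/eqP; rewrite eq_complex /=.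
by apply/andP; split; apply/eqP; field.
Qed.

Lemma normc_branch s : ComplexField.Normc.normc (branch s) = expR (log_radius s).
Proof.
rewrite /branch /= sqrrN !exprMn -mulrDr cos2Dsin2 mulr1 sqrtr_sqr.
by rewrite ger0_norm// expR_ge0.
Qed.

Lemma branch_neq0 s : branch s != 0.
Proof.
apply/eqP => b0; have := branchX s; rewrite b0 expr0n gtn_eqF// => -[/eqP].
by rewrite eq_sym oner_eq0.
Qed.

Lemma is_derive_conv (f g : R -> R) (x df dg : R) :
  is_derive x (1 : R) f df -> f =1 g -> df = dg -> is_derive x (1 : R) g dg.
Proof. by move=> d /funext <- <-. Qed.

Lemma is_derive_log_radius s : is_derive s (1 : R) log_radius (s / (M * (1 + s ^+ 2))).
Proof.
have s0 := one_sqr_gt0 s.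
have s0' : 1 + s ^+ 2 != 0 by rewrite gt_eqF.
have dq : is_derive s (1 : R) (fun s : R => 1 + s ^+ 2) (2 * s).
  apply: (is_derive_conv (is_deriveD (is_derive_cst (1 : R) s 1) (is_deriveX 2 (is_derive_id s (1 : R))))).
    by move=> y; rewrite fctE exprfctE.
  by rewrite add0r /GRing.scale /= expr1 mulr1.
apply: (is_derive_conv (is_deriveZ (2 * M)^-1 (@is_derive1_comp _ (@ln R) _ s _ _ (is_derive1_ln s0) dq))).
  by move=> y; rewrite /log_radius [RHS]mulrC.
by rewrite /GRing.scale /=; field; rewrite M0 s0'.
Qed.

Lemma is_derive_arg s : is_derive s (1 : R) angle ((1 + s ^+ 2)^-1 / M).
Proof.
apply: (is_derive_conv (is_deriveZ M^-1 (is_derive1_atan s))) => [y|].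
  by rewrite /angle [RHS]mulrC.
by rewrite [RHS]mulrC.
Qed.

Lemma is_derive_branch_Re s : is_derive s (1 : R) (fun s => complex.Re (branch s))
  (complex.Re (branch s * Complex s (-1)) / (M * (1 + s ^+ 2))).
Proof.
have s0' : 1 + s ^+ 2 != 0 by rewrite gt_eqF// one_sqr_gt0.
have dE := is_derive1_comp (is_derive_expR (log_radius s)) (is_derive_log_radius s).
have dC := is_derive1_comp (is_derive_cos (angle s)) (is_derive_arg s).
apply: (is_derive_conv (is_deriveM dE dC)) => [//|].
rewrite /GRing.scale /=; field; by rewrite M0 s0'.
Qed.

Lemma is_derive_branch_Im s : is_derive s (1 : R) (fun s => complex.Im (branch s))
  (complex.Im (branch s * Complex s (-1)) / (M * (1 + s ^+ 2))).
Proof.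
have s0' : 1 + s ^+ 2 != 0 by rewrite gt_eqF// one_sqr_gt0.
have dE := is_derive1_comp (is_derive_expR (log_radius s)) (is_derive_log_radius s).
have dC := is_derive1_comp (is_derive_sin (angle s)) (is_derive_arg s).
apply: (is_derive_conv (is_deriveN (is_deriveM dE dC))) => [//|].
rewrite /GRing.scale /=; field; by rewrite M0 s0'.
Qed.
End RootBranch.

(** * The flow of the dihedral field *)

Section ComplexFlow.
Variables (R : realType) (k : nat) (G H : R -> R).
Local Notation C := R[i].
Local Notation m := (k.*2.+3).
Local Notation normc := ComplexField.Normc.normc.
Implicit Types (t s h : R) (z c : C).

(** The dihedral field at [z] is [speed_num z] times [z] on the rays [Im (z ^ m) = 0]. *)
Definition speed_num z : R := complex.Re (z ^+ m) / normc z ^+ m.-1.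

(** On an orbit, [s] is the cotangent of the argument of [z ^ m], and [G] and [H]
    convert it into time and back; the orbit of [c] is run through at the relative speed
    [Num.sg h * normc c]. *)
Definition base_flow t z : C :=
  let u := complex.Re (z ^+ m) in let h := complex.Im (z ^+ m) in
  if h == 0 then ((1 - t * speed_num z)^-1)%:C * z
  else let s := u / h in let c := z / branch m s in
       c * branch m (H (G s + t * (Num.sg h * normc c))).

Lemma base_flow_ray t z : complex.Im (z ^+ m) = 0 ->
  base_flow t z = ((1 - t * speed_num z)^-1)%:C * z.
Proof. by move=> E; rewrite /base_flow E eqxx. Qed.

Lemma orbitX h c s : c ^+ m = Complex 0 h -> (c * branch m s) ^+ m = Complex (h * s) h.
Proof. by move=> E; rewrite exprMn E branchX//; simpc. Qed.

Lemma base_flow_orbit h c s t : h != 0 -> c ^+ m = Complex 0 h ->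
  base_flow t (c * branch m s) = c * branch m (H (G s + t * (Num.sg h * normc c))).
Proof.
move=> h0 E; rewrite /base_flow (orbitX _ E) [complex.Im _]/= (negPf h0) [complex.Re _]/=.
by rewrite [h * s]mulrC mulfK// mulfK ?branch_neq0.
Qed.

Lemma orbit_param z : complex.Im (z ^+ m) != 0 ->
  exists h c s, [/\ h != 0, c ^+ m = Complex 0 h & z = c * branch m s].
Proof.
move=> h0; pose h := complex.Im (z ^+ m); pose s := complex.Re (z ^+ m) / h.
exists h, (z / branch m s), s; split => //; last by rewrite divfK ?branch_neq0.
have E1 : Complex 1 (- s) != 0 by rewrite eq_complex /= oner_eq0.
rewrite exprMn exprVn branchX//; apply: (mulIf E1); rewrite divfK//.
have -> : z ^+ m = Complex (h * s) h.
  by rewrite /s mulrC divfK//; rewrite /h; case: (z ^+ m).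
by apply/eqP; rewrite eq_complex /=; apply/andP; split; apply/eqP; ring.
Qed.

Lemma normcR t : normc t%:C = `|t|.
Proof. by rewrite /= expr0n addr0 sqrtr_sqr. Qed.

Lemma normc_eq0 z : (normc z == 0) = (z == 0).
Proof.
apply/eqP/eqP => [|->]; first exact: ComplexField.Normc.eq0_normc.
exact: ComplexField.Normc.normc0.
Qed.

Lemma realMX (T : R) z n : (T%:C * z) ^+ n = (T ^+ n)%:C * z ^+ n.
Proof. by rewrite exprMn rmorphXn. Qed.

Lemma normX_even (T : R) : `|T| ^+ m.-1 = T ^+ m.-1.
Proof.
have -> : m.-1 = (2 * k.+1)%N by lia.
by rewrite !exprM real_normK// num_real.
Qed.

Lemma sgX_odd (T : R) : Num.sg (T ^+ m) = Num.sg T.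
Proof.
have [->|T0] := eqVneq T 0; first by rewrite expr0n.
rewrite -[m]/(m.-1.+1) exprS sgrM -normX_even (@gtr0_sg _ (_ ^+ _)) ?mulr1//.
by rewrite exprn_gt0// normr_gt0.
Qed.

Lemma speed_numZ (T : R) z : T != 0 -> speed_num (T%:C * z) = T * speed_num z.
Proof.
move=> T0; rewrite /speed_num realMX ComplexField.Normc.normcM normcR exprMn.
rewrite normX_even.
have -> : complex.Re ((T ^+ m)%:C * z ^+ m) = T ^+ m * complex.Re (z ^+ m).
  by case: (z ^+ m) => a b /=; rewrite mul0r subr0.
rewrite -[T ^+ m]/(T ^+ m.-1.+1) exprS invfM.
have := expf_neq0 m.-1 T0; move: (T ^+ m.-1) (normc z ^+ m.-1) => Tm r Tm0.
by rewrite -!mulrA; congr (T * _); rewrite [complex.Re _ * (_ * _)]mulrCA mulVKf.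
Qed.

(** Homogeneity of degree 2 of the field: scaling space by [T] scales time by [T]. This is
    what makes the flow projective. *)
Lemma base_flowZ (T t : R) z : T != 0 ->
  base_flow t (T%:C * z) = T%:C * base_flow (t * T) z.
Proof.
move=> T0; have [h0|h0] := eqVneq (complex.Im (z ^+ m)) 0.
  rewrite !base_flow_ray//; last first.
    by rewrite realMX; case: (z ^+ m) h0 => a b /= ->; rewrite mulr0 mul0r addr0.
  by rewrite speed_numZ// mulrCA [t * (T * _)]mulrA.
have [h [c [s [hn0 cE ->]]]] := orbit_param h0.
have Th0 : T ^+ m * h != 0 by rewrite mulf_neq0// expf_neq0.
have TcE : (T%:C * c) ^+ m = Complex 0 (T ^+ m * h).
  by rewrite realMX cE; apply/eqP; rewrite eq_complex /=; apply/andP; split; apply/eqP; ring.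
rewrite mulrA (base_flow_orbit _ _ Th0 TcE) (base_flow_orbit _ _ hn0 cE) -mulrA.
congr (_ * (_ * branch m (H (G s + _)))).
rewrite ComplexField.Normc.normcM normcR sgrM.
rewrite sgX_odd -mulrA; congr (t * _); rewrite mulrACA -numEsg.
by [].
Qed.
End ComplexFlow.

Section FlowLaws.
Variables (R : realType) (k : nat) (G H : R -> R).
Local Notation C := R[i].
Local Notation m := (k.*2.+3).
Local Notation M := (m%:R : R).
Local Notation normc := ComplexField.Normc.normc.
Local Open Scope classical_set_scope.
Implicit Types (t s h : R) (z c : C).

Hypothesis GK : cancel G H.
Hypothesis HK : forall s : R, \forall y \near G s, G (H y) = y.
Hypothesis dH : forall s : R,
  is_derive (G s) (1 : R) H (M * expR (log_radius m s) ^+ m.+1).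
Local Notation base_flow := (base_flow k G H).

Lemma base_flow0 z : base_flow 0 z = z.
Proof.
have [h0|h0] := eqVneq (complex.Im (z ^+ m)) 0.
  by rewrite base_flow_ray// mul0r subr0 invr1 mul1r.
have [h [c [s [hn0 cE ->]]]] := orbit_param h0.
by rewrite (base_flow_orbit _ _ _ _ hn0 cE) mul0r addr0 GK.
Qed.

Lemma small_product (K e : R) : 0 < e ->
  exists2 d, 0 < d & forall s, `|s| < d -> `|s * K| < e.
Proof.
move=> e0; have K0 : 0 < `|K| + 1 by rewrite ltr_wpDl.
exists (e / (`|K| + 1)); first by rewrite divr_gt0.
move=> s; rewrite ltr_pdivlMr// normrM; apply: le_lt_trans.
by rewrite ler_wpM2l// lerDl.
Qed.

Lemma base_flowD z : exists2 d : R, 0 < d & forall s t, `|s| < d -> `|t| < d ->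
  base_flow (t + s) z = base_flow t (base_flow s z).
Proof.
have [h0|h0] := eqVneq (complex.Im (z ^+ m)) 0.
  have [d d0 dK] := small_product (speed_num k z) ltr01.
  exists d => // s t /dK sK _; rewrite !(base_flow_ray G H _ h0).
  set l := (1 - s * _)^-1.
  have l0 : 1 - s * speed_num k z != 0.
    by rewrite gt_eqF// subr_gt0; apply: le_lt_trans (ler_norm _) sK.
  rewrite base_flow_ray; last first.
    by rewrite realMX; case: (z ^+ m) h0 => a b /= ->; rewrite mulr0 mul0r addr0.
  rewrite speed_numZ ?invr_eq0// mulrA -rmorphM; congr (_%:C * _).
  rewrite /l -invfM; congr (_^-1); rewrite mulrBl mul1r -/l.
  have lE : l * (1 - s * speed_num k z) = 1 by rewrite mulVf.
  by rewrite -mulrA [l * _ * _]mulrAC lE; ring.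
have [h [c [s0 [hn0 cE ->]]]] := orbit_param h0.
have /nbhs_ballP[e /= e0 eH] := HK s0.
have [d d0 dK] := small_product (Num.sg h * normc c) e0.
exists d => // s t /dK sK _; rewrite !(base_flow_orbit _ _ _ _ hn0 cE).
rewrite eH ?mulrDl ?[t * _ + _]addrC ?addrA//.
by rewrite /ball /= opprD addrA subrr sub0r normrN.
Qed.

Lemma mulcJ_normc z : z * conjc z = (normc z ^+ 2)%:C.
Proof.
case: z => a b; rewrite /normc sqr_sqrtr ?addr_ge0 ?sqr_ge0//.
by apply/eqP; rewrite eq_complex /=; apply/andP; split; apply/eqP; ring.
Qed.

Lemma Re_mul z c : complex.Re (z * c) =
  complex.Re z * complex.Re c - complex.Im z * complex.Im c.
Proof. by case: z c => [a b] [u v]. Qed.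

Lemma Im_mul z c : complex.Im (z * c) =
  complex.Re z * complex.Im c + complex.Im z * complex.Re c.
Proof. by case: z c => [a b] [u v]. Qed.

Lemma normcX z n : normc (z ^+ n) = normc z ^+ n.
Proof.
elim: n => [|n IHn]; first exact: ComplexField.Normc.normc1.
by rewrite !exprS ComplexField.Normc.normcM IHn.
Qed.

Lemma is_derive_chain (f g : R -> R) (t df dg : R) :
  is_derive (g t) (1 : R) f df -> is_derive t (1 : R) g dg ->
  is_derive t (1 : R) (fun t => f (g t)) (df * dg).
Proof. by move=> dF dg'; apply: is_derive1_comp. Qed.

Lemma is_derive_affine (a K : R) : is_derive (0 : R) (1 : R) (fun t => a + t * K) K.
Proof.
apply: (is_derive_conv (is_deriveD (is_derive_cst a (0 : R) 1)
  (is_deriveM (is_derive_id (0 : R) (1 : R)) (is_derive_cst K (0 : R) 1)))).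
  by move=> y; rewrite fctE.
by rewrite /GRing.scale /=; ring.
Qed.

(** Multiplying by [conj z] turns the formula of the field into a statement on [z ^ m]. *)
Lemma conj_cancel z D : z != 0 ->
  D * conjc z * (normc z ^+ (2 * k))%:C = conjc (z ^+ m) ->
  D * (z * conjc z) ^+ k = conjc z ^+ m.-1.
Proof.
move=> z0 E; have z0' : conjc z != 0 by rewrite conjc_eq0.
apply: (mulIf z0'); rewrite -exprSr prednK// -conjcX -E.
by rewrite mulcJ_normc -rmorphXn /= -exprM mulrAC.
Qed.

(** The powers of the modulus [rho] coming from the speed of [s] and from the denominator
    [(z conj z) ^ k] add up to [rho ^ (2 m) = 1 + s ^ 2]: this is where the speed
    [M * rho ^ m.+1] comes from. *)
Lemma orbit_speed n (A r rho h s : R) : A != 0 ->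
  r ^+ n.+1 = `|h| -> rho ^+ n.+1 = Num.sqrt (1 + s ^+ 2) ->
  (A * (1 + s ^+ 2))^-1 * (Num.sg h * r * (A * rho ^+ n.+2)) * (r * rho) ^+ n = h.
Proof.
move=> A0 rE rhoE; have s0 : 1 + s ^+ 2 != 0 by rewrite gt_eqF// one_sqr_gt0.
have E : rho ^+ n.+2 * rho ^+ n = 1 + s ^+ 2.
  rewrite -exprD addSnnS addnn -muln2 exprM rhoE sqr_sqrtr//.
  exact/ltW/one_sqr_gt0.
rewrite [RHS](numEsg h) -rE exprMn [r ^+ n.+1]exprS -E; move: s0; rewrite -E.
move: (rho ^+ _) (rho ^+ _) (r ^+ _) (Num.sg h) => u v w sh; rewrite mulf_eq0 negb_or.
by case/andP=> v0 u0; field; rewrite A0 v0 u0.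
Qed.

Lemma is_derive_base_flow z : exists D : C,
  [/\ is_derive (0 : R) (1 : R) (fun t => complex.Re (base_flow t z)) (complex.Re D),
      is_derive (0 : R) (1 : R) (fun t => complex.Im (base_flow t z)) (complex.Im D) &
      D * (z * conjc z) ^+ k = conjc z ^+ m.-1].
Proof.
have [h0|h0] := eqVneq (complex.Im (z ^+ m)) 0.
  set K := speed_num k z; exists (K%:C * z).
  have dK : is_derive (0 : R) (1 : R) (fun t => (1 - t * K)^-1) K.
    have dA : is_derive (0 : R) (1 : R) (fun t : R => 1 - t * K) (- K).
      by apply: (is_derive_conv (is_derive_affine 1 (- K))) => [t|//]; rewrite mulrN.
    have n0 : 1 - 0 * K != 0 by rewrite mul0r subr0 oner_neq0.
    apply: is_derive_eq.
    by rewrite /GRing.scale /= mul0r subr0 expr1n invr1 mulrNN mul1r.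
  have ReZ (a : R) (w : C) : complex.Re (a%:C * w) = complex.Re w * a.
    by case: w => p q /=; rewrite mul0r subr0 mulrC.
  have ImZ (a : R) (w : C) : complex.Im (a%:C * w) = complex.Im w * a.
    by case: w => p q /=; rewrite mul0r addr0 mulrC.
  split.
  - apply: (is_derive_conv (is_deriveZ (complex.Re z) dK)) => [t|]; last by rewrite ReZ.
    by rewrite base_flow_ray// ReZ.
  - apply: (is_derive_conv (is_deriveZ (complex.Im z) dK)) => [t|]; last by rewrite ImZ.
    by rewrite base_flow_ray// ImZ.
  have [->|z0] := eqVneq z 0; first by rewrite mulr0 mul0r conjc0 expr0n.
  apply: conj_cancel => //.
  have -> : z ^+ m = (complex.Re (z ^+ m))%:C by case: (z ^+ m) h0 => a b /= ->.
  rewrite conjc_real -[K%:C * z * _]mulrA mulcJ_normc -mulrA -rmorphM -rmorphM /=.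
  have r0 : normc z != 0 by rewrite normc_eq0.
  by rewrite -exprD mul2n /K /speed_num divfK// expf_neq0.
have [h [c [s [hn0 cE zE]]]] := orbit_param h0.
pose b := branch m s; pose kap := Num.sg h * normc c.
pose sp := kap * (M * expR (log_radius m s) ^+ m.+1).
have dh : is_derive (0 : R) (1 : R) (fun t => H (G s + t * kap)) sp.
  have dH0 : is_derive (G s + 0 * kap) (1 : R) H (M * expR (log_radius m s) ^+ m.+1).
    by rewrite mul0r addr0.
  have dC := is_derive_chain (g := fun t => G s + t * kap) dH0 (is_derive_affine (G s) kap).
  apply: (is_derive_conv dC) => //.
  by rewrite mulrC.
have hE : H (G s + 0 * kap) = s by rewrite mul0r addr0 GK.
pose e : C := b * Complex s (-1); pose q := M * (1 + s ^+ 2).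
have dRe : is_derive (0 : R) (1 : R)
    (fun t => complex.Re (branch m (H (G s + t * kap)))) (complex.Re e / q * sp).
  have dB : is_derive (H (G s + 0 * kap)) (1 : R) (fun s => complex.Re (branch m s)) (complex.Re e / q).
    by rewrite hE; apply: is_derive_branch_Re.
  exact: (is_derive_chain (g := fun t => H (G s + t * kap)) dB dh).
have dIm : is_derive (0 : R) (1 : R)
    (fun t => complex.Im (branch m (H (G s + t * kap)))) (complex.Im e / q * sp).
  have dB : is_derive (H (G s + 0 * kap)) (1 : R) (fun s => complex.Im (branch m s)) (complex.Im e / q).
    by rewrite hE; apply: is_derive_branch_Im.
  exact: (is_derive_chain (g := fun t => H (G s + t * kap)) dB dh).
have M0 : M != 0 by rewrite pnatr_eq0.
have hcE : normc c ^+ m = `|h|.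
  by rewrite -normcX cE /= expr0n add0r sqrtr_sqr.
exists (c * e * (q^-1 * sp)%:C); split.
- rewrite zE.
  apply: (is_derive_conv (is_deriveB (is_deriveZ (complex.Re c) dRe) (is_deriveZ (complex.Im c) dIm))).
    by move=> t; rewrite (base_flow_orbit _ _ _ _ hn0 cE) Re_mul.
  by rewrite !Re_mul Im_mul [complex.Re _%:C]/= [complex.Im _%:C]/= /GRing.scale /=; ring.
- rewrite zE.
  apply: (is_derive_conv (is_deriveD (is_deriveZ (complex.Re c) dIm) (is_deriveZ (complex.Im c) dRe))).
    by move=> t; rewrite (base_flow_orbit _ _ _ _ hn0 cE) Im_mul.
  by rewrite !Im_mul Re_mul [complex.Re _%:C]/= [complex.Im _%:C]/= /GRing.scale /=; ring.
apply: conj_cancel; first by apply: contraNneq h0 => ->; rewrite expr0n.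
have -> : c * e * (q^-1 * sp)%:C = z * (Complex s (-1) * (q^-1 * sp)%:C) by rewrite zE /e -/b -!mulrA.
have -> : z ^+ m = Complex (h * s) h by rewrite zE (orbitX s cE).
rewrite [z * _ * conjc z]mulrAC mulcJ_normc.
have scE : q^-1 * sp * (normc z ^+ (2 + 2 * k)) = h.
  rewrite mul2n add2n zE ComplexField.Normc.normcM normc_branch.
  exact: (orbit_speed (n := k.*2.+2) M0 hcE (expR_log_radius (m := m) isT s)).
rewrite -[RHS]/(Complex (h * s) (- h)) -{1 2}scE exprD.
by move: (normc z) (q^-1 * sp) => r a; apply/eqP; rewrite eq_complex /=; apply/andP; split; apply/eqP; ring.
Qed.
End FlowLaws.

Section BaseSuperflow.
Variables (R : realType) (k : nat).
Local Notation C := R[i].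
Local Notation m := (k.*2.+3).
Local Notation M := (m%:R : R).
Local Open Scope classical_set_scope.
Implicit Types (t s : R) (x : 'cV[R]_2).

Lemma speed_continuous :
  continuous (fun s : R => (M * expR (log_radius m s) ^+ m.+1)^-1).
Proof.
move=> s; apply: cvgV.
  by rewrite mulf_neq0 ?pnatr_eq0// expf_neq0// gt_eqF// expR_gt0.
apply: cvgM; first exact: cvg_cst.
apply: (@continuous_comp _ _ _ (fun s => expR (log_radius m s)) (fun y => y ^+ m.+1));
  last exact: exprn_continuous.
apply: (@continuous_comp _ _ _ (log_radius m) expR); last exact: continuous_expR.
have dL := is_derive_log_radius (m := m) isT s.
by apply/differentiable_continuous/derivable1_diffP; exact: (@ex_derive _ _ _ _ _ _ _ dL).
Qed.

Lemma toC_is_derive (f : R -> C) (D : C) (t : R) :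
  is_derive t (1 : R) (fun t => complex.Re (f t)) (complex.Re D) ->
  is_derive t (1 : R) (fun t => complex.Im (f t)) (complex.Im D) ->
  is_derive t (1 : R) (fun t => ofC (f t)) (ofC D).
Proof.
move=> dRe dIm.
have dE i j : is_derive t (1 : R) (fun t => ofC (f t) i j) (ofC D i j).
  have [->|->] := ord2P i.
    by apply: (is_derive_conv dRe) => [u|]; rewrite !mxE.
  by apply: (is_derive_conv dIm) => [u|]; rewrite !mxE.
have dM : derivable (fun t => ofC (f t)) t 1.
  by apply/derivable_mxP => i j; exact: (@ex_derive _ _ _ _ _ _ _ (dE i j)).
apply: DeriveDef => //; rewrite derive_mx//; apply/matrixP => i j; rewrite mxE.
exact: (@derive_val _ _ _ _ _ _ _ (dE i j)).
Qed.

Lemma base_field_has_flow : exists phi : 'cV[R]_2 -> 'cV[R]_2,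
  projective_flow_on (vdom (base_field R k)) phi /\
  vector_field_on (vdom (base_field R k)) phi (vfun (base_field R k)).
Proof.
have g_gt0 s : 0 < (M * expR (log_radius m s) ^+ m.+1)^-1.
  by rewrite invr_gt0 mulr_gt0 ?ltr0n// exprn_gt0// expR_gt0.
have [G [H [GK dH' HK]]] := separation_of_variables speed_continuous g_gt0.
have dH s : is_derive (G s) (1 : R) H (M * expR (log_radius m s) ^+ m.+1).
  by have := dH' s; rewrite invrK.
pose phi x := ofC (base_flow k G H 1 (toC x)); exists phi.
have flowE t x : flow phi t x = ofC (base_flow k G H t (toC x)).
  rewrite /flow /phi; have [->|t0] := eqVneq t 0; first by rewrite base_flow0// toCK.
  apply: toC_inj; rewrite !toCZ base_flowZ// !ofCK [1 * t]mul1r.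
  by move: (base_flow _ _ _ _ _) => v; rewrite mulrA -rmorphM mulVf// mul1r.
have dphi : vector_field_on (vdom (base_field R k)) phi (vfun (base_field R k)).
  move=> x Qx; have [D [dRe dIm DE]] := is_derive_base_flow GK dH (toC x).
  have -> : vfun (base_field R k) x = ofC D.
    apply: toC_inj; rewrite ofCK; apply: (mulIf (vdom_base_field Qx)).
    by rewrite toC_base_field// DE.
  have -> : (fun t => flow phi t x) = fun t => ofC (base_flow k G H t (toC x)).
    by apply/funext => t; exact: flowE.
  exact: toC_is_derive.
split=> // x Qx; split.
  have [d d0 dD] := base_flowD k HK (toC x).
  exists d => // s t sd td; rewrite !flowE ofCK; congr ofC; exact: dD.
have : {for 0, continuous (fun t => flow phi t x)}.
  by apply/differentiable_continuous/derivable1_diffP; exact: (@ex_derive _ _ _ _ _ _ _ (dphi x Qx)).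
rewrite /prop_for /continuous_at {2}/flow eqxx => c0.
exact: cvg_within_filter.
Qed.
End BaseSuperflow.

(** * The dihedral superflow *)

Lemma prim_root_neq0 (F : fieldType) n (w : F) : n.-primitive_root w -> w != 0.
Proof.
move=> w_prim; have := prim_expr_order w_prim; apply: contra_eq_neq => ->.
by rewrite expr0n gtn_eqF ?(prim_order_gt0 w_prim)// eq_sym oner_eq0.
Qed.

Section RootOfUnity.
Variables (R : realType) (m : nat).
Hypothesis m_gt0 : (0 < m)%N.
Implicit Types (x : R).

Lemma cos_eq1 x : 0 < x -> x < pi *+ 2 -> cos x != 1.
Proof.
move=> x0 xpi; have s0 : 0 < sin (x / 2).
  by apply: sin_gt0_pi; rewrite divr_gt0//= ltr_pdivrMr// mulr_natr.
have -> : x = (x / 2) *+ 2 by rewrite -mulr_natr divfK// pnatr_eq0.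
rewrite cos_mulr2n; have E := cos2Dsin2 (x / 2).
by have := exprn_gt0 2 s0; apply: contraTneq => c1; rewrite -leNgt; lra.
Qed.

Lemma primitive_root_of_unity : exists w : R[i],
  [/\ m.-primitive_root w, conjc w = w^-1 & `|w| = 1].
Proof.
pose t : R := pi *+ 2 / m%:R; pose w := Complex (cos t) (- sin t).
have M0 : 0 < (m%:R : R) by rewrite ltr0n.
have wm : w ^+ m = 1.
  by rewrite /w de_moivre /t divfK ?gt_eqF// cos2pi sin2pi oppr0.
have w1 : w * conjc w = 1.
  apply/eqP; rewrite eq_complex /=; apply/andP; split; apply/eqP; last by ring.
  by rewrite -(cos2Dsin2 t); ring.
exists w; split.
- rewrite /primitive_root_of_unity m_gt0 /=; apply/forallP => i.
  rewrite unity_rootE; apply/eqP; have [->|im] := eqVneq i.+1 m; first by rewrite wm eqxx.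
  apply/negbTE; rewrite /w de_moivre eq_complex /= negb_and; apply/orP; left.
  have pi2 : 0 < (pi *+ 2 : R) by have := pi_gt0 R; lra.
  have t_pos : 0 < t by rewrite divr_gt0.
  apply: cos_eq1; first by rewrite mulr_gt0// ltr0n.
  rewrite /t mulrAC ltr_pdivrMr// ltr_pM2l // ltr_nat.
  by rewrite ltn_neqAle im ltn_ord.
- have w0 : w != 0 by apply: contra_eq_neq w1 => ->; rewrite mul0r eq_sym oner_eq0.
  by apply: (mulfI w0); rewrite w1 divff.
by apply/eqP; have := @pexprn_eq1 _ `|w| m (normr_ge0 _); rewrite -normrX wm normr1 eqxx gtn_eqF//= => <-.
Qed.
End RootOfUnity.

Section ImageGroup.
Variables (R : realType) (n : nat) (gT : finGroupType) (G : {group gT}).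
Variable f : gT -> 'M[R]_n.
Local Open Scope classical_set_scope.
Hypotheses (fM : {in G &, forall g h, f (g * h)%g = f g *m f h})
  (f1 : f 1%g = 1%:M) (f_inj : {in G &, injective f}).

Let Gamma : set 'M[R]_n := f @` [set g | g \in G].

Lemma image_invmx g : g \in G -> f g \in unitmx /\ invmx (f g) = f g^-1%g.
Proof.
move=> Gg; have E : f g *m f g^-1%g = 1%:M by rewrite -fM ?groupV// mulgV.
have [u _] := mulmx1_unit E; split=> //.
by rewrite -[LHS]mulmx1 -E mulKmx.
Qed.

Lemma image_finite_linear_group : finite_linear_group Gamma.
Proof.
split.
- by apply: finite_image; exact: finite_finset.
- by move=> _ [g Gg <-]; have [] := image_invmx Gg.
- by exists 1%g; rewrite /= ?group1.
- by move=> _ _ [g Gg <-] [h Gh <-]; exists (g * h)%g; rewrite ?fM//= groupM.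
- by move=> _ [g Gg <-]; have [_ ->] := image_invmx Gg; exists g^-1%g; rewrite //= groupV.
Qed.

Lemma image_linear_isog : linear_isog Gamma G.
Proof.
exists f => //; split.
- by move=> g Gg; exists g.
- by move=> g h /set_mem Gg /set_mem Gh; apply: f_inj.
- by move=> _ [g Gg <-]; exists g.
Qed.
End ImageGroup.

Section DihedralRepresentation.
Variables (R : realType) (m : nat) (w : R[i]).
Hypotheses (m_gt1 : (1 < m)%N) (w_prim : m.-primitive_root w) (w_conj : conjc w = w^-1).
Local Open Scope classical_set_scope.
Implicit Types (i j : nat) (b c : bool).

Let gT := dihedral_gtype m.*2.

(** Normal form in the dihedral group: the products [x ^ i * y ^ b] exhaust the group by
    the relations, and are pairwise distinct by counting. *)
Lemma dihedral_generators : exists x y : gT,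
  [/\ (x ^+ m = 1)%g, (forall i j b c, (x ^+ i * y ^+ b) * (x ^+ j * y ^+ c) =
      x ^+ (i + (if b then j * m.-1 else j))%N * y ^+ (b (+) c))%g &
   bijective (fun p : 'I_m * bool => x ^+ p.1 * y ^+ p.2)%g].
Proof.
have := homg_refl [set: gT]%G.
rewrite (Grp_dihedral m_gt1) => /existsP[[x y]] /eqP[xyG xm y2 xy].
have yy : (y * y = 1)%g by [].
have yx j : (y * x ^+ j = x ^+ (j * m.-1)%N * y)%g.
  have -> : (x ^+ (j * m.-1)%N = x ^- j)%g.
    apply/eqP; rewrite eq_sym eq_invg_mul -expgD -mulnS prednK ?(ltnW m_gt1)//.
    by rewrite mulnC expgM xm expg1n.
  have yV : y^-1%g = y by apply/eqP; rewrite eq_invg_mul yy.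
  by rewrite -expVgn -xy -conjXg conjgE -!mulgA yy mulg1 yV.
exists x, y; split=> //.
- move=> i j b c; case: b => /=.
    rewrite expg1 mulgA -[(x ^+ i * y * x ^+ j)%g]mulgA yx !mulgA -expgD -mulgA.
    by case: c => /=; rewrite ?expg1 ?yy ?expg0 ?mulg1.
  by rewrite expg0 mulg1 mulgA expgD.
have xy_surj (g : gT) : exists p : 'I_m * bool, (x ^+ p.1 * y ^+ p.2)%g = g.
  have nxy : (<[y]> \subset 'N(<[x]>))%g.
    by rewrite cycle_subG; apply/normP; rewrite -cycleJ xy cycleV.
  have : g \in (<[x]> <*> <[y]>)%g by rewrite xyG inE.
  rewrite norm_joinEr// => /mulsgP[_ _ /cycleP[i ->] /cycleP[j ->] ->].
  exists (Ordinal (ltn_pmod i (ltnW m_gt1)), odd j) => /=.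
  by rewrite (expg_mod _ xm) -modn2 (expg_mod _ y2).
have [s /= sxy] := choice xy_surj.
have sK : cancel s (fun p : 'I_m * bool => x ^+ p.1 * y ^+ p.2)%g by [].
have s_bij : bijective s.
  apply: (fintype.inj_card_bij (can_inj sK)).
  by rewrite card_prod card_ord card_bool -cardsT card_dihedral// muln2.
exact: (bij_can_bij s_bij sK).
Qed.

Lemma dihedral_representation : exists f : gT -> 'M[R]_2,
  [/\ {morph f : g h / (g * h)%g >-> g *m h}, f 1%g = 1%:M, injective f,
      forall i b, exists g, f g = mxC (w ^+ i) b &
      forall g, exists i b, f g = mxC (w ^+ i) b].
Proof.
have [x [y [xm xyM [s sK Ks]]]] := dihedral_generators.
have wm := prim_expr_order w_prim.
have w0 := prim_root_neq0 w_prim.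
pose f (g : gT) := mxC (w ^+ (s g).1) (s g).2.
have fE i b : f (x ^+ i * y ^+ b)%g = mxC (w ^+ i) b.
  have E := sK (Ordinal (ltn_pmod i (ltnW m_gt1)), b).
  by rewrite /= (expg_mod _ xm) in E; rewrite /f E /= (prim_expr_mod w_prim).
have cjw j b : cj b (w ^+ j) = w ^+ (if b then (j * m.-1)%N else j).
  case: b => //=; rewrite conjcX w_conj mulnC exprM; congr (_ ^+ _).
  by apply: (mulfI w0); rewrite divff// -exprS prednK ?(ltnW m_gt1)// wm.
exists f; split.
- move=> g h; rewrite -[g]Ks -[h]Ks xyM !fE mxCM cjw.
  by rewrite exprD.
- by have := fE 0%N false; rewrite /= !expg0 mulg1 expr0 mxC1.
- move=> g h /mxC_inj[|E bE]; first exact: expf_neq0.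
  rewrite -[g]Ks -[h]Ks; congr (_ ^+ _ * _ ^+ _)%g; last by rewrite bE.
  by move/eqP: E; rewrite (eq_prim_root_expr w_prim) !modn_small// => /eqP.
- by move=> i b; exists (x ^+ i * y ^+ b)%g.
by move=> g; exists (s g).1, (s g).2.
Qed.
End DihedralRepresentation.

Section DihedralSuperflow.
Variables (R : realType) (k : nat).
Local Notation m := (k.*2.+3).
Local Open Scope classical_set_scope.

Lemma dihedral_superflow : exists Gamma : set 'M[R]_2,
  [/\ finite_linear_group Gamma, linear_isog Gamma (dihedral_group m) &
      exists phi : 'cV[R]_2 -> 'cV[R]_2, superflow Gamma phi].
Proof.
have [w [w_prim w_conj w_norm]] := @primitive_root_of_unity R m isT.
have [f [fM f1 f_inj fS fE]] := dihedral_representation (m := m) isT w_prim w_conj.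
have fMG : {in dihedral_group m &, forall g h, f (g * h)%g = f g *m f h}.
  by move=> g h _ _; exact: fM.
have f_injG : {in dihedral_group m &, injective f} by move=> g h _ _; exact: f_inj.
pose Gamma := f @` [set g | g \in dihedral_group m].
have GammaS i b : Gamma (mxC (w ^+ i) b).
  by have [g <-] := fS i b; exists g; rewrite //= inE.
exists Gamma; split.
- exact: image_finite_linear_group.
- exact: image_linear_isog.
have [phi [phi_flow phi_field]] := base_field_has_flow R k.
exists phi, (base_field R k); split=> //.
- split; [exact: base_field_nonzero | exact: base_field_homogeneous |].
  move=> _ [g _ <-] x; have [i [b ->]] := fE g => Qx Qgx.
  have w0 : w ^+ i != 0 by rewrite expf_neq0// (prim_root_neq0 w_prim).
  have wi_conj : conjc (w ^+ i) = (w ^+ i)^-1 by rewrite conjcX w_conj exprVn.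
  have wi_m : (w ^+ i) ^+ m = 1.
    by rewrite -exprM mulnC exprM (prim_expr_order w_prim) expr1n.
  by rewrite base_field_invariant// mulKmx// mxC_unit.
move=> Q Qh QG; apply: (base_field_minimal w_prim w_conj w_norm _ _ Qh QG).
- by have := GammaS 1%N false; rewrite expr1.
- by have := GammaS 0%N true; rewrite expr0.
Qed.
End DihedralSuperflow.

(** * Plane matrices of finite order *)

Section PlaneInvolutions.
Variable R : realFieldType.
Implicit Types (g h Z : 'M[R]_2) (c : R) (v : 'cV[R]_2).

Lemma sqr_root_of_unity c n : (0 < n)%N -> c ^+ n = 1 -> c ^+ 2 = 1.
Proof.
move=> n0 cn; have : `|c| ^+ n = 1 by rewrite -normrX cn normr1.
move/eqP; rewrite pexprn_eq1// gtn_eqF//= => /eqP c1.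
by rewrite -[c ^+ 2]ger0_norm ?sqr_ge0// normrX c1 expr1n.
Qed.

Lemma cayley_hamilton2 h : h ^+ 2 = \tr h *: h - (\det h)%:M.
Proof.
rewrite (expand_det_row _ ord0) /mxtrace !big_ord2 /cofactor !det_mx11 !mxE.
apply/matrixP => i j; rewrite expr2 !mxE big_ord2.
have l0 (o : 'I_1) : lift (ord0 : 'I_2) o = ord_max by apply: val_inj; case: o => -[].
have l1 (o : 'I_1) : lift (ord_max : 'I_2) o = ord0 by apply: val_inj; case: o => -[].
rewrite !l0 !l1.
by have [->|->] := ord2P i; have [->|->] := ord2P j; rewrite /=; ring.
Qed.
Lemma eigenX g v c n : g *m v = c *: v -> g ^+ n *m v = c ^+ n *: v.
Proof.
move=> gv; elim: n => [|n IHn]; first by rewrite !expr0 mul1mx scale1r.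
by rewrite !exprS -mulmxE -mulmxA IHn -scalemxAr gv scalerA mulrC.
Qed.

Lemma scale_injr v c c' : v != 0 -> c *: v = c' *: v -> c = c'.
Proof.
move=> v0 /eqP; rewrite -subr_eq0 -scalerBl scaler_eq0 (negPf v0) orbF subr_eq0.
by move/eqP.
Qed.

(** A real eigenvalue of finite order is a sign, and so is the determinant. Hence [g ^ 2]
    has eigenvalue 1 and determinant 1, so it is unipotent, and being of finite order it is
    the identity. *)
Lemma real_eigenvector_involution g v c n : v != 0 -> g *m v = c *: v ->
  (0 < n)%N -> g ^+ n = 1 -> g ^+ 2 = 1.
Proof.
move=> v0 gv n0 gn; pose h := g ^+ 2.
have cn : c ^+ n = 1.
  by apply: (scale_injr v0); rewrite -(eigenX _ gv) gn mul1mx scale1r.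
have hv : h *m v = v by rewrite (eigenX _ gv) (sqr_root_of_unity n0 cn) scale1r.
have hn : h ^+ n = 1 by rewrite -exprM mulnC exprM gn expr1n.
have dh : \det h = 1.
  have detX p : \det (g ^+ p) = (\det g) ^+ p.
    elim: p => [|p IHp]; first by rewrite !expr0 det1.
    by rewrite !exprS -IHp -det_mulmx.
  by rewrite detX; apply: (sqr_root_of_unity n0); rewrite -detX gn det1.
have trh : \tr h = 2.
  have := congr1 (mulmx^~ v) (cayley_hamilton2 h).
  rewrite dh expr2 -mulmxE -mulmxA hv hv mulmxBl -scalemxAl hv mul1mx => E.
  by apply: (scale_injr v0); rewrite -[LHS](subrK v) -E scaler_nat mulr2n.
pose N := h - 1; have N2 : N * N = 0.
  by rewrite -expr2 sqrrB1 cayley_hamilton2 trh dh scaler_nat addrAC subrK addrN.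
have hX p : h ^+ p = 1 + N *+ p.
  elim: p => [|p IHp]; first by rewrite expr0 mulr0n addr0.
  have hE : h = 1 + N by rewrite /N addrC subrK.
  rewrite exprS IHp {1}hE mulrDl mul1r mulrDr mulr1 mulrnAr N2 mul0rn addr0.
  by rewrite -addrA -mulrSr.
have := hX n; rewrite hn => /eqP; rewrite eq_sym addrC -subr_eq0 addrK -scaler_nat.
by rewrite scaler_eq0 pnatr_eq0 gtn_eqF//= subr_eq0 => /eqP hE.
Qed.
Lemma eigen_col g (A : 'M[R]_2) c : A != 0 -> g *m A = c *: A ->
  exists2 v : 'cV[R]_2, v != 0 & g *m v = c *: v.
Proof.
move=> /matrix0Pn[i [j Aij]] gA; exists (col j A).
  by apply/cV0Pn; exists i; rewrite mxE.
by apply/colP => l; have /matrixP/(_ l j) := gA; rewrite !mxE => <-; apply: eq_bigr => u _; rewrite mxE.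
Qed.

Lemma eigen_row g (A : 'M[R]_2) c : A != 0 -> A *m g = c *: A ->
  exists2 l : 'rV[R]_2, l != 0 & l *m g = c *: l.
Proof.
move=> /matrix0Pn[i [j Aij]] gA; exists (row i A).
  by apply/rV0Pn; exists j; rewrite mxE.
by apply/rowP => l; have /matrixP/(_ i l) := gA; rewrite !mxE => <-; apply: eq_bigr => u _; rewrite mxE.
Qed.

(** By Cayley-Hamilton an involution with nonzero trace is scalar. *)
Lemma trace_reflection Z : Z ^+ 2 = 1 -> Z != 1 -> Z != - 1 -> \tr Z = 0.
Proof.
move=> Z2 Z1 ZN1; apply: contraNeq Z1 => t0.
have ZE : Z = ((\tr Z)^-1 * (1 + \det Z))%:M.
  have := cayley_hamilton2 Z; rewrite Z2 => /eqP; rewrite eq_sym subr_eq => /eqP E.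
  by rewrite -scale_scalar_mx raddfD /= -[1%:M]/(1 : 'M[R]_2) -E scalerA mulVf// scale1r.
move: ZE ZN1 Z2; move: (_ * _) => c ->; rewrite expr2 -mulmxE -scalar_mxM => ZN1.
move=> /matrixP/(_ ord0 ord0); rewrite !mxE eqxx /= !mulr1n => /eqP.
rewrite -expr2 sqrf_eq1 => /orP[/eqP->//|/eqP cN]; move: ZN1.
by rewrite cN raddfN eqxx.
Qed.

Lemma reflection_coordinates (a b c d p q r : R) :
  p * p + q * r = 1 -> c * p + d * r = r * a + - p * c ->
  a * q + b * - p = p * b + q * d -> a * p + b * r = p * a + q * c ->
  let u := (a + d) / 2 in let v := (p * (a - d) + q * c + r * b) / 2 in
  [/\ a = u + v * p, b = v * q, c = v * r & d = u - v * p].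
Proof.
move=> H E1 E2 E3 u v; rewrite {}/u {}/v.
have hb := congr1 ( *%R b) H; have hc := congr1 ( *%R c) H.
have ha := congr1 ( *%R (a - d)) H.
have e1 x := congr1 ( *%R x) E1; have e2 x := congr1 ( *%R x) E2.
have e3 x := congr1 ( *%R x) E3.
split.
- by have := e1 q; have := e2 r; lra.
- by have := e2 p; have := e3 q; lra.
- by have := e1 p; have := e3 r; lra.
by have := e1 q; have := e2 r; lra.
Qed.

Lemma commutant_reflection Z g : Z ^+ 2 = 1 -> Z != 1 -> Z != - 1 ->
  g * Z = Z * g -> exists a b, g = a%:M + b *: Z.
Proof.
move=> Z2 Z1 ZN1 gZ; have := trace_reflection Z2 Z1 ZN1.
rewrite /mxtrace big_ord2 => /eqP; rewrite addrC addr_eq0 => /eqP s.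
have := Z2 => /matrixP/(_ ord0 ord0); rewrite expr2 !mxE big_ord2 eqxx mulr1n => H.
have := gZ => /matrixP E; have := E ord0 ord0; have := E ord0 ord_max; have := E ord_max ord0.
rewrite !mxE !big_ord2 s.
set p := Z ord0 ord0; set q := Z ord0 ord_max; set r := Z ord_max ord0.
move=> E1 E2 E3; have [] := reflection_coordinates H E1 E2 E3.
set u := (_ / 2); set v := (_ / 2) => ga gb gc gd; exists u, v.
apply/matrixP => i j; have [->|->] := ord2P i; have [->|->] := ord2P j;
  by rewrite !mxE /= ?mulr1n ?mulr0n ?add0r// s mulrN.
Qed.

(** A map commuting with a reflection [Z] preserves its two axes, and a real number of
    finite order is a sign, so only the four choices of signs on the axes remain. *)
Lemma finite_order_commutant Z g n : Z ^+ 2 = 1 -> Z != 1 -> Z != - 1 ->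
  g * Z = Z * g -> (0 < n)%N -> g ^+ n = 1 -> [\/ g = 1, g = - 1, g = Z | g = - Z].
Proof.
move=> Z2 Z1 ZN1 gZ n0 gn; have [a [b gE]] := commutant_reflection Z2 Z1 ZN1 gZ.
have [v v0 Zv] : exists2 v : 'cV[R]_2, v != 0 & Z *m v = 1 *: v.
  apply: (@eigen_col Z (Z + 1)); first by rewrite addr_eq0.
  by rewrite mulmxE mulrDr mulr1 -expr2 Z2 addrC scale1r.
have gv : g *m v = (a + b) *: v.
  by rewrite gE mulmxDl mul_scalar_mx -scalemxAl Zv scalerA mulr1 scalerDl.
have g2 := real_eigenvector_involution v0 gv n0 gn.
have [->|g1] := eqVneq g 1; first by constructor 1.
have [->|gN1] := eqVneq g (- 1); first by constructor 2.
have a0 : a = 0.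
  have := trace_reflection g2 g1 gN1; rewrite gE raddfD /= mxtraceZ mxtrace_scalar.
  rewrite (trace_reflection Z2 Z1 ZN1) mulr0 addr0 => /eqP.
  by rewrite -mulr_natr mulf_eq0 pnatr_eq0 orbF => /eqP.
move: gE g2; rewrite a0 raddf0 add0r => ->; rewrite exprZn Z2.
move=> /matrixP/(_ ord0 ord0); rewrite !mxE eqxx mulr1 => /eqP.
rewrite sqrf_eq1 => /orP[/eqP->|/eqP->]; first by rewrite scale1r; constructor 3.
by rewrite scaleN1r; constructor 4.
Qed.
End PlaneInvolutions.

(** * Competing invariant fields *)

Section PlaneFields.
Variable R : realType.
Implicit Types (Q : ratVField R 2) (x v : 'cV[R]_2) (G : set 'M[R]_2) (g : 'M[R]_2).

Lemma mpoly_at_opp (p : mpoly 2 R) x : mpoly_at (mscale (-1) (-1) p) x = mpoly_at p (- x).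
Proof.
rewrite /mpoly_at meval_mscale; apply: meval_eq => i.
by rewrite mxE; case: (ord2P i) => -> /=; rewrite mulN1r.
Qed.

(** Homogeneity with [t = -1] gives [Q (- x) = Q x] and invariance [Q (- x) = - Q x]. *)
Lemma no_antipodal_field Q G : G (- 1%:M) -> homogeneous2 Q ->
  invariant_under G Q -> ~ vnonzero Q.
Proof.
move=> GN1 Qh QG [i Qi].
have D'0 : mscale (-1) (-1) (vden Q) != 0.
  by rewrite mscale_neq0 ?oppr_eq0 ?oner_neq0// vden_neq0.
have [x] := mpoly_at_neq0 (mulf_neq0 (mulf_neq0 (vden_neq0 Q) D'0) Qi).
rewrite /mpoly_at !mevalM !mulf_eq0 !negb_or => /andP[/andP[Qx]].
rewrite [meval _ _]mpoly_at_opp => QNx Qix.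
have gx : - 1%:M *m x = -1 *: x by rewrite mulNmx mul1mx scaleN1r.
have QNx' : vdom Q (-1 *: x) by rewrite scaleN1r.
have := QG _ GN1 x Qx; rewrite gx => /(_ QNx').
rewrite (Qh _ _ Qx QNx') sqrrN expr1n scale1r => E.
have u1 : - 1%:M \in @unitmx R 2.
  have N1N1 : - 1%:M *m - 1%:M = 1%:M :> 'M[R]_2 by rewrite mulNmx mul1mx opprK.
  by have [] := mulmx1_unit N1N1.
have := congr1 (mulmx (- 1%:M)) E; rewrite mulKVmx// mulNmx mul1mx => /matrixP/(_ i ord0).
rewrite !mxE => /eqP; rewrite -addr_eq0 -mulr2n mulrn_eq0 /= mulf_eq0 invr_eq0.
by rewrite (negPf Qix) (negPf Qx).
Qed.

Section LinearImage.
Variables (g : 'M[R]_2) (Q : ratVField R 2).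
Hypothesis g_unit : g \in unitmx.

Let num i : mpoly 2 R := \sum_j g i j *: vnum Q j.

Let image_reduced (P : mpoly 2 R) : (forall i, exists A, num i = A * P) ->
  (exists B, vden Q = B * P) -> P \is a GRing.unit.
Proof.
move=> numP; apply: vreduced => i; have [A AE] := choice numP.
exists (\sum_j invmx g i j *: A j); rewrite mulr_suml.
under eq_bigr do rewrite -scalerAl -AE scaler_sumr.
rewrite exchange_big /=; under eq_bigr => l _.
  under eq_bigr do rewrite scalerA.
  rewrite -scaler_suml; over.
have gE l : \sum_j invmx g i j * g j l = (i == l)%:R.
  by have /matrixP/(_ i l) := mulVmx g_unit; rewrite !mxE.
transitivity (\sum_l (i == l)%:R *: vnum Q l); last by apply: eq_bigr => l _; rewrite -gE.
rewrite (bigD1 i)//= big1 => [|l li]; first by rewrite eqxx scale1r addr0.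
by rewrite eq_sym (negPf li) scale0r.
Qed.

(** The field [g Q] is reduced with the denominator of [Q], since [g] is invertible over
    the constants. *)
Definition linear_image : ratVField R 2 := RatVField (vden_neq0 Q) image_reduced.

Lemma vfun_linear_image x : vfun linear_image x = g *m vfun Q x.
Proof.
apply/matrixP => i j; rewrite !mxE /mpoly_at raddf_sum /= mulr_suml.
by apply: eq_bigr => l _; rewrite !mxE mevalZ mulrA.
Qed.
End LinearImage.

Definition linear_form (l : 'rV[R]_2) : mpoly 2 R :=
  \sum_j l ord0 j *: mpolyX R (mnm1 j).

Lemma linear_form_at l x : mpoly_at (linear_form l) x = (l *m x) ord0 ord0.
Proof.
rewrite mxE /mpoly_at raddf_sum; apply: eq_bigr => j _ /=.
by rewrite mevalZ mevalXU.
Qed.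

Lemma linear_form_neq0 l : l != 0 -> linear_form l != 0.
Proof.
move=> /rV0Pn[j]; apply: contraNneq => l0.
by have := linear_form_at l (delta_mx j ord0); rewrite l0 /mpoly_at meval0 -colE mxE => <-.
Qed.

Section QuadraticField.
Variables (a b : 'rV[R]_2) (e : 'cV[R]_2).
Let one_neq0 : (1 : mpoly 2 R) != 0. Proof. exact: oner_neq0. Qed.

Let quadratic_reduced (P : mpoly 2 R) :
  (forall i, exists A, e i ord0 *: (linear_form a * linear_form b) = A * P) ->
  (exists B, 1 = B * P) -> P \is a GRing.unit.
Proof.
move=> _ [B PB]; apply/unitrPr; exists B; by rewrite mulrC.
Qed.

(** Polynomial fields have denominator degree 0, so by minimality they can only be
    multiples of a superflow field. *)
Definition quadratic_field : ratVField R 2 := RatVField one_neq0 quadratic_reduced.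

Lemma vfun_quadratic_field x :
  vfun quadratic_field x = ((a *m x) ord0 ord0 * (b *m x) ord0 ord0) *: e.
Proof.
apply/colP => i; rewrite !mxE /mpoly_at /= meval1 divr1 mevalZ mevalM.
by rewrite -!/(mpoly_at _ _) !linear_form_at !mxE mulrC.
Qed.

Lemma vdom_quadratic_field x : vdom quadratic_field x.
Proof. by rewrite /vdom /= /mpoly_at meval1 oner_neq0. Qed.

Lemma homogeneous2_quadratic_field : homogeneous2 quadratic_field.
Proof.
move=> t x _ _; rewrite !vfun_quadratic_field -!scalemxAr scalerA !mxE.
by congr (_ *: _); ring.
Qed.

Lemma quadratic_field_equivariant g (al be ep : R) x :
  g *m g = 1%:M -> a *m g = al *: a -> b *m g = be *: b -> g *m e = ep *: e ->
  al * be * ep = 1 ->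
  invmx g *m vfun quadratic_field (g *m x) = vfun quadratic_field x.
Proof.
move=> g2 ag bg ge E; have [g_unit _] := mulmx1_unit g2.
have -> : invmx g = g by rewrite -[RHS]mul1mx -(mulVmx g_unit) -mulmxA g2 mulmx1.
rewrite !vfun_quadratic_field !mulmxA ag bg -!scalemxAl -scalemxAr ge scalerA !mxE.
congr (_ *: _).
by rewrite -[RHS]mulr1 -E; ring.
Qed.

Lemma den_degree_quadratic_field : den_degree quadratic_field = 0%N.
Proof. by rewrite /den_degree /= msize1. Qed.
End QuadraticField.
End PlaneFields.

Section NoSuperflow.
Variables (R : realType) (Gamma : set 'M[R]_2) (Q : ratVField R 2).
Implicit Types (g h : 'M[R]_2) (x : 'cV[R]_2).

Hypotheses (Q_neq0 : vnonzero Q) (Q_homogeneous : homogeneous2 Q)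
  (Q_invariant : invariant_under Gamma Q).
Hypothesis Q_minimal : forall Q' : ratVField R 2,
  homogeneous2 Q' -> invariant_under Gamma Q' ->
  scalar_multiple Q' Q \/ (den_degree Q < den_degree Q')%N.

(** [g Q] is again invariant, with the same denominator, hence proportional to [Q], so any
    value of [Q] is an eigenvector of [g]. *)
Lemma commuting_element_involution g n : g \in unitmx ->
  (forall h, Gamma h -> h \in unitmx /\ g *m h = h *m g) ->
  (0 < n)%N -> g ^+ n = 1 -> g ^+ 2 = 1.
Proof.
move=> g_unit gC n0 gn; have [i Qi] := Q_neq0.
have [x] := mpoly_at_neq0 (mulf_neq0 (vden_neq0 Q) Qi).
rewrite /mpoly_at mevalM mulf_eq0 negb_or => /andP[Qx Qix].
have v0 : vfun Q x != 0.
  by apply/cV0Pn; exists i; rewrite mxE mulf_neq0// invr_eq0.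
case: (@Q_minimal (linear_image Q g_unit)).
- move=> t y Qy Qty; rewrite !vfun_linear_image (Q_homogeneous Qy Qty).
  by rewrite -scalemxAr.
- move=> h Gh y Qy Qhy; rewrite !vfun_linear_image; have [h_unit ghC] := gC h Gh.
  rewrite -[in RHS](Q_invariant Gh Qy Qhy) !mulmxA; congr (_ *m _).
  rewrite -[RHS](mulKmx h_unit); congr (_ *m _).
  by rewrite mulmxA -ghC -mulmxA mulmxV// mulmx1.
- case=> c /(_ x Qx Qx); rewrite vfun_linear_image => gv.
  exact: (real_eigenvector_involution v0 gv n0 gn).
by rewrite ltnn.
Qed.

(** Let [e, f] span the axes of [g], and let the linear forms [a, b] vanish on [f] and [e].
    The invariant fields [a ^ 2 e] and [a b f] have different directions, so they are not
    both multiples of [Q]. *)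
Lemma reflection_not_minimal g : g ^+ 2 = 1 -> g != 1 -> g != - 1 ->
  (forall h, Gamma h -> h = 1 \/ h = g) -> False.
Proof.
move=> g2 g1 gN1 Gg.
have gg : g *m g = 1%:M by [].
have [A0 B0] : g + 1 != 0 /\ g - 1 != 0 by rewrite addr_eq0 subr_eq0.
have gA : g *m (g + 1) = 1 *: (g + 1).
  by rewrite mulmxE mulrDr mulr1 -expr2 g2 addrC scale1r.
have Ag : (g + 1) *m g = 1 *: (g + 1).
  by rewrite mulmxE mulrDl mul1r -expr2 g2 addrC scale1r.
have gB : g *m (g - 1) = -1 *: (g - 1).
  by rewrite mulmxE mulrBr mulr1 -expr2 g2 scaleN1r opprB.
have Bg : (g - 1) *m g = -1 *: (g - 1).
  by rewrite mulmxE mulrBl mul1r -expr2 g2 scaleN1r opprB.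
have [e e0 ge] := eigen_col A0 gA; have [a a0 ag] := eigen_row A0 Ag.
have [f f0 gf] := eigen_col B0 gB; have [b b0 bg] := eigen_row B0 Bg.
have minimal l1 l2 u al be ep : l1 *m g = al *: l1 -> l2 *m g = be *: l2 ->
    g *m u = ep *: u -> al * be * ep = 1 ->
    scalar_multiple (quadratic_field l1 l2 u) Q.
  move=> l1g l2g gu E; case: (@Q_minimal (quadratic_field l1 l2 u)) => //.
  - exact: homogeneous2_quadratic_field.
  - move=> h /Gg[->|->] x _ _; first by rewrite invmx1 !mul1mx.
    exact: (quadratic_field_equivariant _ gg l1g l2g gu E).
  by rewrite den_degree_quadratic_field.
have [c1 E1] := minimal a a e 1 1 1 ag ag ge ltac:(ring).
have [c2 E2] := minimal a b f 1 (-1) (-1) ag bg gf ltac:(ring).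
have [x] := mpoly_at_neq0 (mulf_neq0 (mulf_neq0 (linear_form_neq0 a0) (linear_form_neq0 b0)) (vden_neq0 Q)).
rewrite /mpoly_at !mevalM !mulf_eq0 !negb_or -!/(mpoly_at _ _) !linear_form_at.
move=> /andP[/andP[ax bx] Qx].
have := E1 x Qx (vdom_quadratic_field _ _ _ x).
have := E2 x Qx (vdom_quadratic_field _ _ _ x).
rewrite !vfun_quadratic_field; move: (vfun Q x) (mulf_neq0 ax bx) (mulf_neq0 ax ax) => v.
move: (_ * _) (_ * _) => p q q0 p0 fE eE.
have E : (c2 * p) *: e = (c1 * q) *: f.
  by rewrite -2!scalerA eE fE !scalerA mulrC.
have : g *m ((c2 * p) *: e) = g *m ((c1 * q) *: f) by rewrite E.
rewrite -!scalemxAr ge gf scale1r scaleN1r scalerN -E => /eqP.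
rewrite -addr_eq0 -mulr2n -scaler_nat scaler_eq0 pnatr_eq0 /= scaler_eq0 (negPf e0) orbF.
rewrite mulf_eq0 (negPf p0) orbF.
move=> /eqP c20; move/eqP: fE; rewrite c20 scale0r scaler_eq0 (negPf q0) (negPf f0).
by [].
Qed.
End NoSuperflow.

(** * Groups without superflow *)

Lemma mxC_conj_reflection (R : realType) : [/\ mxC 1 true ^+ 2 = 1 :> 'M[R]_2, mxC 1 true != 1 :> 'M[R]_2 &
  mxC 1 true != - 1 :> 'M[R]_2].
Proof.
have c1 : (1 : R[i]) != 0 := oner_neq0 _.
split.
- by rewrite expr2 -mulmxE mxCM mul1r /cj conjc1 mxC1.
- by apply/eqP => E; have [] := mxC_inj c1 (etrans E (esym (mxC1 R))).
have -> : - 1 = mxC (-1) false :> 'M[R]_2.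
  by apply: mx_ext => x; apply: toC_inj; rewrite toC_mxC mulNmx mul1mx -scaleN1r toCZ rmorphN1.
by apply/eqP => /(mxC_inj c1)[].
Qed.

Section FaithfulImage.
Variables (R : realType) (gT : finGroupType) (G : {group gT}) (f : gT -> 'M[R]_2).
Hypotheses (fM : {in G &, forall g h, f (g * h)%g = f g *m f h})
  (f1 : f 1%g = 1) (f_inj : {in G &, injective f}).
Implicit Types (g z : gT) (A : {group gT}).

Lemma imageX g n : g \in G -> f (g ^+ n)%g = f g ^+ n.
Proof.
move=> Gg; elim: n => [|n IHn]; first by rewrite expg0 expr0.
by rewrite expgS exprS fM ?groupX// IHn.
Qed.

Lemma image_order g : g \in G -> f g ^+ #[g]%g = 1.
Proof. by move=> Gg; rewrite -imageX// expg_order. Qed.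

(** If the image of [z] is a reflection [Z], the image of [A] lies in [{1, -1, Z, -Z}], and
    [- Z] is excluded since [(- Z) Z = - 1]. *)
Lemma abelian_involution A z : A \subset G -> abelian A ->
  (forall g, g \in A -> f g != - 1) -> z \in A -> (z ^+ 2 = 1)%g -> (z != 1)%g ->
  A \subset [set 1%g; z].
Proof.
move=> sAG cA noN Az z2 z1; have Gz := fintype.subsetP sAG _ Az.
have Z2 : f z ^+ 2 = 1 by rewrite -imageX// z2.
have Z1 : f z != 1 by apply: contraNneq z1; rewrite -f1 => /(f_inj Gz (group1 G)) ->.
apply/fintype.subsetP => g Ag; have Gg := fintype.subsetP sAG _ Ag; rewrite !inE.
have gZ : f g * f z = f z * f g.
  by rewrite -!mulmxE -!fM// (centsP cA).
case: (finite_order_commutant Z2 Z1 (noN _ Az) gZ (order_gt0 g) (image_order Gg)) => E.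
- by rewrite (f_inj Gg (group1 G)) ?eqxx// E f1.
- by have := noN _ Ag; rewrite E eqxx.
- by rewrite (f_inj Gg Gz E) eqxx orbT.
have := noN _ (groupM Ag Az); rewrite fM// E mulmxE mulNr -expr2 Z2 eqxx.
by [].
Qed.

(** A subgroup of order 4 is abelian with an involution and too large for
    [abelian_involution]. *)
Lemma antipode_of_order4 : (4 %| #|G|)%N -> exists2 g, g \in G & f g = - 1.
Proof.
move=> G4; have [P sylP] := Sylow_exists 2 G.
have [sPG pP] := (pHall_sub sylP, pHall_pgroup sylP).
have logP : (2 <= logn 2 #|P|)%N.
  by rewrite (card_Hall sylP) p_part pfactorK// -pfactor_dvdn.
have [A [sAP _ cardA]] := normal_pgroup pP (normal_refl P) logP.
have sAG := fintype.subset_trans sAP sPG.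
apply: contrapT => noN.
have noN' g : g \in A -> f g != - 1.
  by move=> Ag; apply/eqP => gN; apply: noN; exists g => //; apply: (fintype.subsetP sAG).
have [||z Az oz] := @pgroup.Cauchy gT 2 A; rewrite ?cardA//.
have cA : abelian A by apply: (p2group_abelian (pgroupS sAP pP)); rewrite cardA pfactorK.
have z2 : (z ^+ 2 = 1)%g by rewrite -oz expg_order.
have z1 : (z != 1)%g by rewrite -order_eq1 oz.
have := subset_leq_card (abelian_involution sAG cA noN' Az z2 z1).
by rewrite cardA cards2; case: (_ != _).
Qed.

Variable Gamma : set 'M[R]_2.
Hypothesis GammaE : forall h, Gamma h <-> exists2 g, g \in G & f g = h.

Lemma superflow_no_antipode phi g : superflow Gamma phi -> g \in G -> f g != - 1.
Proof.
move=> [Q [_ _ [Q0 Qh QG] _]] Gg; apply/eqP => gN.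
apply: (no_antipodal_field _ Qh QG Q0); apply/GammaE; exists g => //.
Qed.

(** All elements are involutions, so the group has at most one besides the identity. For
    the trivial group any reflection serves. *)
Lemma no_superflow_abelian phi : abelian G -> ~ superflow Gamma phi.
Proof.
move=> cG Gphi; have noN g := superflow_no_antipode (g := g) Gphi.
case: Gphi => Q [_ _ [Q0 Qh QG] Qmin].
have f_unit g : g \in G -> f g \in unitmx.
  move=> Gg; have E : f g *m f g^-1%g = 1%:M by rewrite -fM ?groupV// mulgV.
  by have [] := mulmx1_unit E.
have inv g : g \in G -> (g ^+ 2 = 1)%g.
  move=> Gg; apply: f_inj; rewrite ?groupX// f1 imageX//.
  apply: (commuting_element_involution Q0 Qh QG Qmin (f_unit _ Gg) _ (order_gt0 g) (image_order Gg)).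
  move=> _ /GammaE[h Gh <-]; split; first exact: f_unit.
  by rewrite -!fM// (centsP cG).
have [[g Gg g1]|noG] := pselect (exists2 g, g \in G & (g != 1)%g).
  have sG := abelian_involution (fintype.subxx G) cG noN Gg (inv g Gg) g1.
  apply: (@reflection_not_minimal _ _ _ Qmin (f g)).
  - by rewrite -imageX// inv.
  - by apply: contraNneq g1; rewrite -f1 => /(f_inj Gg (group1 G)) ->.
  - exact: noN.
  move=> _ /GammaE[h Gh <-]; have := fintype.subsetP sG _ Gh.
  by rewrite !inE => /orP[/eqP->|/eqP->]; [left; rewrite f1|right].
have [r2 r1 rN] := mxC_conj_reflection R.
apply: (@reflection_not_minimal _ _ _ Qmin (mxC 1 true)) => // _ /GammaE[h Gh <-].
left; have [->//|h1] := eqVneq h 1%g; case: noG; by exists h.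
Qed.

Lemma no_superflow_order4 phi : (4 %| #|G|)%N -> ~ superflow Gamma phi.
Proof.
by move=> /antipode_of_order4[g Gg gN] /superflow_no_antipode/(_ Gg)/eqP.
Qed.
End FaithfulImage.

Section Nonexistence.
Variables (R : realType) (Gamma : set 'M[R]_2).

Lemma linear_isog_faithful (gT : finGroupType) (G : {group gT}) :
  finite_linear_group Gamma -> linear_isog Gamma G ->
  exists f : gT -> 'M[R]_2, [/\ {in G &, forall g h, f (g * h)%g = f g *m f h},
    f 1%g = 1, {in G &, injective f} &
    forall h, Gamma h <-> exists2 g, g \in G & f g = h].
Proof.
move=> [_ Gamma_unit _ _ _] [f [fG f_inj f_surj] fM]; exists f; split=> //.
- have u : f 1%g \in unitmx by apply: Gamma_unit; apply: fG; exact: group1.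
  by rewrite -[LHS](mulKmx u) -fM ?group1// mulg1 mulVmx.
- by move=> g h Gg Gh; apply: f_inj; rewrite inE.
move=> h; split=> [/f_surj[g Gg <-]|[g Gg <-]]; first by exists g.
exact: fG.
Qed.

Lemma no_dihedral_superflow d phi : (0 < d)%N -> finite_linear_group Gamma ->
  linear_isog Gamma (dihedral_group (2 * d)) -> ~ superflow Gamma phi.
Proof.
move=> d0 fin /(linear_isog_faithful fin)[f [fM f1 f_inj GammaE]].
apply: (no_superflow_order4 fM f1 f_inj GammaE).
by rewrite card_dihedral ?leq_pmulr// -mul2n mulnA dvdn_mulr.
Qed.

Lemma no_cyclic_superflow d phi : finite_linear_group Gamma ->
  linear_isog Gamma (cyclic_group d) -> ~ superflow Gamma phi.
Proof.
move=> fin /(linear_isog_faithful fin)[f [fM f1 f_inj GammaE]].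
apply: (no_superflow_abelian fM f1 f_inj GammaE).
exact: FinRing.zmod_abelian.
Qed.
End Nonexistence.

Local Close Scope ring_scope.
Local Close Scope complex_scope.
Theorem theorem2p4 (R : realType) :
  (forall d : nat, (0 < d)%N ->
     exists Gamma : set 'M[R]_2,
       [/\ finite_linear_group Gamma,
           linear_isog Gamma (dihedral_group (2 * d + 1)) &
           exists phi : 'cV[R]_2 -> 'cV[R]_2, superflow Gamma phi]) /\
  (forall d : nat, (0 < d)%N ->
     forall Gamma : set 'M[R]_2,
       finite_linear_group Gamma ->
       linear_isog Gamma (dihedral_group (2 * d)) \/
         linear_isog Gamma (cyclic_group d) ->
       ~ exists phi : 'cV[R]_2 -> 'cV[R]_2, superflow Gamma phi).
Proof.
split=> d d_gt0.
  (* [k = d - 1] *)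
  have -> : (2 * d + 1 = d.-1.*2.+3)%N by case: d d_gt0 => // d _; lia.
  exact: dihedral_superflow.
move=> Gamma fin GammaE [phi superphi]; case: GammaE => isog.
  exact: no_dihedral_superflow d_gt0 fin isog superphi.
exact: no_cyclic_superflow fin isog superphi.
Qed.
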